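(* Let $n\in\mathbb{N}$, let $[\cdot]_\beta$ be the unnormalised expectation of the $\mathbb{R}^n$ model on $\Lambda$, and let $\mathbb{E}_{i,\boldsymbol{\ell}}$ be the expectation of the simple random walk with its local times. Let $g\colon\mathbb{R}^\Lambda\to\mathbb{R}$ be a smooth compactly supported function, let $a\in\Lambda$, and let $s\in\mathbb{R}$. Then $$\Big[g\big(\tfrac12|\theta_s\boldsymbol{u}|^2\big)\,\delta_{u_0}(u_a)\Big]_\beta=\Big[\mathbb{E}_{a,\frac12|\boldsymbol{u}|^2}\,g\big(\boldsymbol{L}_{\tau(\frac{s^2}{2})}\big)\,\delta_{u_0}(u_a)\Big]_\beta,$$ where $\tau(\gamma)=\inf\{t\mid L_t^a\ge\gamma\}$ and $u_0=(0,\dots,0)\in\mathbb{R}^n$.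
   Context: $\Lambda$ is a finite set and $\beta=(\beta_{ij})_{i,j\in\Lambda}$ are edge weights with $\beta_{ij}=\beta_{ji}\ge0$ such that the graph with vertex set $\Lambda$ and edge set $\{\{i,j\}\mid\beta_{ij}>0\}$ is connected. Bold symbols denote objects indexed by $\Lambda$. For $\boldsymbol{u}=(u_i)_{i\in\Lambda}\in(\mathbb{R}^n)^\Lambda$ let $|\boldsymbol{u}|^2=(u_i\cdot u_i)_{i\in\Lambda}$, $H_\beta(\boldsymbol{u})=\frac14\sum_{i,j\in\Lambda}\beta_{ij}|u_i-u_j|^2$, and $[F]_\beta=\int_{(\mathbb{R}^n)^\Lambda}F(\boldsymbol{u})e^{-H_\beta(\boldsymbol{u})}\,d\boldsymbol{u}$ (Lebesgue measure). $[F\,\delta_{u_0}(u_a)]_\beta$ denotes the expectation with the spin at $a$ fixed to $u_0$: $\int_{(\mathbb{R}^n)^{\Lambda\setminus\{a\}}}F(\boldsymbol{u})e^{-H_\beta(\boldsymbol{u})}\prod_{i\ne a}du_i$ with $u_a=u_0$. $\theta_s\boldsymbol{u}=(u_i+se^1)_{i\in\Lambda}$ with $e^1=(1,0,\dots,0)\in\mathbb{R}^n$. Simple random walk: $X_t$ is the Markov jump process on $\Lambda$ jumping from $i$ to $j$ at rate $\beta_{ij}$; $L_t^i=L_0^i+\int_0^t1_{X_r=i}\,dr$; under $\mathbb{E}_{i,\boldsymbol{\ell}}$, $X_0=i$ and $\boldsymbol{L}_0=\boldsymbol{\ell}$. *)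

(* Defs.v *)
From HB Require Import structures.
From mathcomp Require Import all_boot all_order all_algebra.
From mathcomp Require Import all_classical all_reals all_analysis.

Set Implicit Arguments.
Unset Strict Implicit.
Unset Printing Implicit Defensive.
Import Order.TTheory GRing.Theory Num.Theory.
Import numFieldNormedType.Exports.

Local Open Scope classical_set_scope.
Local Open Scope ring_scope.

Section lebesgue_tuple.
Context {R : realType}.
Local Open Scope ereal_scope.

Definition cons_pair n (z : R * n.-tuple R) : n.+1.-tuple R :=
  [tuple of z.1 :: z.2].

Fixpoint lebesgue_tuple (N : nat) : set (N.-tuple R) -> \bar R :=
  match N with
  | 0 => \d_[tuple]
  | N'.+1 =>
      pushforward (lebesgue_measure \x @lebesgue_tuple N') (@cons_pair N')
  end.
Arguments lebesgue_tuple : clear implicits.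

Lemma measurable_cons_pair n :
  measurable_fun [set: R * n.-tuple R] (@cons_pair n).
Proof. exact: (measurable_cons measurable_fst measurable_snd). Qed.

Lemma measurable_uncons n :
  measurable_fun [set: n.+1.-tuple R]
    (fun t : n.+1.-tuple R => (thead t, [tuple of behead t])).
Proof.
apply: measurable_fun_pair; first exact: measurable_tnth.
exact: measurable_behead.
Qed.

Section lebesgue_tuple_step.
Variables (n : nat) (m : {sigma_finite_measure set (n.-tuple R) -> \bar R}).

Definition lebesgue_step : set (n.+1.-tuple R) -> \bar R :=
  pushforward (lebesgue_measure \x m) (@cons_pair n).

Let lebesgue_step0 : lebesgue_step set0 = 0.
Proof. by rewrite /lebesgue_step /pushforward preimage_set0 measure0. Qed.

Let lebesgue_step_ge0 A : 0 <= lebesgue_step A.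
Proof. by rewrite /lebesgue_step /pushforward; exact: measure_ge0. Qed.

Let lebesgue_step_sigma_additive : semi_sigma_additive lebesgue_step.
Proof.
exact: (@measure_semi_sigma_additive _ _ _
  (@measure_function_pushforward__canonical__measure_function_Measure _ _ _ _ _
    (lebesgue_measure \x m) _ (@measurable_cons_pair n))).
Qed.

HB.instance Definition _ := isMeasure.Build _ _ _ lebesgue_step
  lebesgue_step0 lebesgue_step_ge0 lebesgue_step_sigma_additive.

Let lebesgue_step_sigma_finite : sigma_finite setT lebesgue_step.
Proof.
have /sigma_finiteP[F [TF ndF Foo]] := sigma_finiteT (@lebesgue_measure R).
have /sigma_finiteP[G [TG ndG Goo]] := sigma_finiteT m.
pose u (t : n.+1.-tuple R) := (thead t, [tuple of behead t]).
exists (fun k => u @^-1` (F k `*` G k)).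
  apply/seteqP; split=> // t _.
  have [p _ Fp] : (\bigcup_k F k) (u t).1 by rewrite -TF.
  have [q _ Gq] : (\bigcup_k G k) (u t).2 by rewrite -TG.
  exists (maxn p q) => //; split.
    by move: Fp; exact/subsetPset/ndF/leq_maxl.
  by move: Gq; exact/subsetPset/ndG/leq_maxr.
move=> k; have [mFk Fkoo] := Foo k; have [mGk Gkoo] := Goo k; split.
  rewrite -[X in measurable X]setTI; apply: measurable_uncons => //.
  exact: measurableX.
rewrite /lebesgue_step /pushforward -comp_preimage (_ : _ \o _ = id); last first.
  by apply/funext => -[x t]; rewrite /u/=; congr pair; exact: val_inj.
by rewrite preimage_id product_measure1E// lte_mul_pinfty// ge0_fin_numE.
Qed.

HB.instance Definition _ := Measure_isSigmaFinite.Build _ _ _ lebesgue_step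
  lebesgue_step_sigma_finite.

End lebesgue_tuple_step.

Lemma lebesgue_tuple_sigma_finite_measure N :
  {mu : {sigma_finite_measure set (N.-tuple R) -> \bar R} |
    mu = lebesgue_tuple N :> (set (N.-tuple R) -> \bar R)}.
Proof.
elim: N => [|N [mu IH]]; first by exists (\d_[tuple]).
by exists (lebesgue_step mu); rewrite /= -IH.
Qed.

Section instances.
Variable N : nat.
Let s := lebesgue_tuple_sigma_finite_measure N.

Let lebesgue_tuple0 : lebesgue_tuple N set0 = 0.
Proof. by rewrite -(svalP s) measure0. Qed.

Let lebesgue_tuple_ge0 A : 0 <= lebesgue_tuple N A.
Proof. by rewrite -(svalP s); exact: measure_ge0. Qed.

Let lebesgue_tuple_sigma_additive : semi_sigma_additive (lebesgue_tuple N).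
Proof. by rewrite -(svalP s); exact: measure_semi_sigma_additive. Qed.

HB.instance Definition _ := isMeasure.Build _ _ _ (lebesgue_tuple N)
  lebesgue_tuple0 lebesgue_tuple_ge0 lebesgue_tuple_sigma_additive.

Let lebesgue_tuple_sigma_finite : sigma_finite setT (lebesgue_tuple N).
Proof. by rewrite -(svalP s); exact: sigma_finiteT. Qed.

HB.instance Definition _ := Measure_isSigmaFinite.Build _ _ _ (lebesgue_tuple N)
  lebesgue_tuple_sigma_finite.

End instances.

Lemma lebesgue_tuple_box N (A : 'I_N -> set R) :
  (forall k, measurable (A k)) ->
  lebesgue_tuple N [set t | forall k, A k (tnth t k)] =
  \prod_(k < N) lebesgue_measure (A k).
Proof.
elim: N A => [|N IH] A mA.
  by rewrite big_ord0 /= diracE mem_set// => -[].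
rewrite big_ord_recl -IH//= /pushforward.
rewrite -(product_measure1E lebesgue_measure (lebesgue_tuple N))//; first last.
- have -> : [set t : N.-tuple R | forall k, A (lift ord0 k) (tnth t k)] =
      \bigcap_(k in [set: 'I_N]) (@tnth N R ^~ k @^-1` A (lift ord0 k)).
    by apply/seteqP; split=> t /= tA k; [move=> _; exact: tA|exact: (tA k I)].
  apply: fin_bigcap_measurable => // k _.
  by rewrite -[X in measurable X]setTI; exact: measurable_tnth.
- exact: mA.
congr (product_measure1 _ _ _); apply/seteqP; split=> -[x t] /=.
  move=> tA; split=> [|k]; [exact: (tA ord0)|].
  by have := tA (lift ord0 k); rewrite tnthS.
move=> [xA tA] k; have [->|k0] := eqVneq k ord0; first exact: xA.
by case: (unliftP ord0 k) k0 => [j ->|->]; rewrite ?eqxx// tnthS.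
Qed.

End lebesgue_tuple.
Arguments lebesgue_tuple {R} N.

Section test_functions.
Context {R : realType} {Lambda : finType}.
Implicit Types (g : {ptws Lambda -> R} -> R) (x : {ptws Lambda -> R}).

Definition slice g x (i : Lambda) (t : R) : R :=
  g (fun j => if j == i then t else x j).

Definition partial (i : Lambda) g : {ptws Lambda -> R} -> R :=
  fun x => derive1 (slice g x i) (x i).

Definition smooth g : Prop := forall s : seq Lambda,
  let h := foldr partial g s in
  continuous h /\ forall x i, derivable (slice h x i) (x i) 1.

Definition compactly_supported g : Prop :=
  compact (closure [set x | g x != 0]).

End test_functions.

Section spin_model.
Context {R : realType} {Lambda : finType} {n : nat}.
Implicit Types (beta : Lambda -> Lambda -> R) (u : Lambda -> 'rV[R]_n).

(* The library norm on 'rV[R]_n is the sup norm, hence this explicit one. *)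
Definition sqnorm (v : 'rV[R]_n) : R := \sum_(k < n) v 0 k ^+ 2.

Definition energy beta u : R :=
  4^-1 * \sum_(i : Lambda) \sum_(j : Lambda) beta i j * sqnorm (u i - u j).

Definition half_sqnorm u : Lambda -> R := fun i => sqnorm (u i) / 2.

(* For 0 < n this is (1, 0, ..., 0). *)
Definition e1 : 'rV[R]_n := \row_(k < n) (k == 0%N :> nat)%:R.

Definition theta (s : R) u : Lambda -> 'rV[R]_n := fun i => u i + s *: e1.

Definition free_coord (a : Lambda) : finType :=
  ({i : Lambda | i != a} * 'I_n)%type.

Definition pinned_config (a : Lambda) (u0 : 'rV[R]_n)
    (t : #|free_coord a|.-tuple R) : Lambda -> 'rV[R]_n :=
  fun i => if insub i is Some j
           then \row_(k < n) tnth t (enum_rank ((j, k) : free_coord a))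
           else u0.

(* The unnormalised expectation [F delta_{u0}(u_a)]_beta. *)
Definition pinned_expectation beta (a : Lambda) (u0 : 'rV[R]_n)
    (F : (Lambda -> 'rV[R]_n) -> \bar R) : \bar R :=
  (\int[lebesgue_tuple #|free_coord a|]_t
    (F (pinned_config u0 t) * (expR (- energy beta (pinned_config u0 t)))%:E))%E.

End spin_model.

Section random_walk.
Context {R : realType} {Lambda : finType} {d : measure_display}
  {Omega : measurableType d}.
Implicit Types X : R -> Omega -> Lambda.
Local Open Scope ereal_scope.

Definition edge_weights (beta : Lambda -> Lambda -> R) : Prop :=
  [/\ forall i j, beta i j = beta j i,
      forall i j, (0 <= beta i j)%R
    & forall i j, connect (fun k l => (0 < beta k l)%R) i j].

(* p t i j is the probability to go from i to j in time t. *)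
Definition transition_semigroup (p : R -> Lambda -> Lambda -> R) : Prop :=
  [/\ forall t i j, (0 <= t)%R -> (0 <= p t i j)%R,
      forall t i, (0 <= t)%R -> (\sum_(j : Lambda) p t i j = 1)%R,
      forall i j, p 0%R i j = (i == j)%:R
    & forall s t i j, (0 <= s)%R -> (0 <= t)%R ->
        p (s + t)%R i j = (\sum_(k : Lambda) p s i k * p t k j)%R].

Definition has_jump_rates (beta : Lambda -> Lambda -> R)
    (p : R -> Lambda -> Lambda -> R) : Prop :=
  forall i j, i != j -> (p h i j / h)%R @[h --> 0^'+] --> beta i j.

(* Time-homogeneous Markov property with respect to the natural filtration,
   written without dividing by the probability of the conditioning event. *)
Definition markov (p : R -> Lambda -> Lambda -> R)
    (P : probability Omega R) X : Prop :=
  forall (past : seq (R * Lambda)) (t h : R) (i j : Lambda),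
    (0 <= h)%R -> (forall q, q \in past -> (0 <= q.1 <= t)%R) -> (0 <= t)%R ->
    let A := [set w | forall q, q \in past -> X q.1 w = q.2] in
    P (A `&` [set w | X t w = i] `&` [set w | X (t + h)%R w = j]) =
    P (A `&` [set w | X t w = i]) * (p h i j)%:E.

(* Each path is right-continuous with left limits for the discrete topology on
   Lambda, i.e. it is a step function with finitely many jumps in any compact
   time interval. *)
Definition step_paths X : Prop := forall w t, (0 <= t)%R ->
  (\forall r \near t^'+, X r w = X t w) /\
  ((0 < t)%R -> exists i, \forall r \near t^'-, X r w = i).

(* P i l is the law of the walk and its local times under which X_0 = i and
   L_0 = l almost surely; the corresponding expectation is E_{i,l}. *)
Definition simple_random_walk (beta : Lambda -> Lambda -> R)
    (P : Lambda -> (Lambda -> R) -> probability Omega R) X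
    (L0 : Lambda -> Omega -> R) : Prop :=
  [/\ forall t i, (0 <= t)%R -> measurable [set w | X t w = i],
      forall i, measurable_fun [set: Omega] (L0 i),
      step_paths X,
      forall i l, P i l [set w | X 0%R w = i /\ forall j, L0 j w = l j] = 1
    & exists p, [/\ transition_semigroup p, has_jump_rates beta p
                  & forall i l, markov p (P i l) X]].

Definition local_time X (L0 : Lambda -> Omega -> R) (t : R) (w : Omega) :
    Lambda -> R := fun i =>
  (L0 i w + \int[lebesgue_measure]_(r in `[0, t]) (X r w == i)%:R)%R.

(* When the set is empty the library's real inf is 0; for a walk on a finite
   connected graph this happens with probability 0. *)
Definition tau X (L0 : Lambda -> Omega -> R) (a : Lambda)
    (gamma : R) (w : Omega) : R :=
  inf [set t | (0 <= t)%R /\ (gamma <= local_time X L0 t w a)%R].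

End random_walk.

(* Main.v *)
(* The occupation functional [E exp (- k . L)] of the walk stopped at the inverse
   local time [tau gamma] equals [exp (- c gamma)], where [c] is the effective
   conductance from [a] to the killing rates [k]: if [h] is the minimiser of the
   killed Dirichlet form with [h a = 1] and [c] the minimum, then
   [h (X_t) exp (- k . L_t + c L_t^a)] is a martingale.  This is made rigorous by
   sampling the walk at the times [r / N], solving the resulting recursion up to
   [o(1)], and squeezing the path functional between [gamma' < gamma].  On the
   Gaussian side, completing the square along [h] and translating Lebesgue measure
   gives the same factor [exp (- c s^2 / 2)].  So both sides agree on exponential
   functions of the local times; in the variables [exp (- l_i)] these are
   monomials, and the multivariate Bernstein approximation extends the identity to
   compactly supported continuous [g]. *)
Require Import Defs.
From HB Require Import structures.
From mathcomp Require Import all_boot all_order all_algebra.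
From mathcomp Require Import all_classical all_reals all_analysis.
From mathcomp Require Import measurable_realfun.
From mathcomp Require Import ring lra zify.
Set Implicit Arguments.
Unset Strict Implicit.
Unset Printing Implicit Defensive.
Import Order.TTheory GRing.Theory Num.Theory.
Import numFieldNormedType.Exports.
Local Open Scope classical_set_scope.
Local Open Scope ring_scope.

(** * The killed Dirichlet form *)

(** The law of the walk is given through finite-dimensional distributions and jump rates at time 0,
    so the martingale is replaced by a one-step recursion for the chain sampled with time step
    [1 / N]. Its one-step defect is only [o(1 / N)], and the number of steps before stopping is
    unbounded. What saves the estimate is killing bounded below by some [kappa > 0]: every step
    contracts errors by [exp (- kappa / N)], and [o(1 / N) / (1 - exp (- kappa / N))] tends to 0
    whatever the number of steps. Cutting the path after finitely many steps is harmless for the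
    same reason. Uniform killing that tends to 0 then yields recurrence, because [c <= \sum_i k i].

    The approximation uses the integer rates [kap i + 2]. The summand 2 keeps the killing away from
    0, and since [2 * (|u_i|^2 / 2) = |u_i|^2] it also supplies the Gaussian that dominates every
    integral over configurations.

    The level [s^2 / 2] is half the squared norm of [0 + s e1]: the spin at [a] is pinned at 0, so
    the local time at [a] starts from 0 and is stopped at the value that [theta s] gives to this
    spin. *)

Lemma solve_injective_system (R : realType) (T : finType) (m : T -> T -> R)
    (b : T -> R) :
  (forall v : T -> R, (forall i, \sum_j m i j * v j = 0) -> forall i, v i = 0) ->
  exists v : T -> R, forall i, \sum_j m i j * v j = b i.
Proof.
(* [M] is the transpose of [m], so that the system acts on row vectors. *)
move=> inj; pose M := \matrix_(j < #|T|, i < #|T|) m (enum_val i) (enum_val j).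
have mulM (v : 'rV[R]_#|T|) i :
    (v *m M) 0 (enum_rank i) = \sum_j m i j * v 0 (enum_rank j).
  rewrite mxE (reindex enum_rank) /=; last first.
    by exists enum_val => j _; rewrite ?enum_rankK ?enum_valK.
  by apply: eq_bigr => j _; rewrite mxE !enum_rankK mulrC.
have Mfree : row_free M.
  rewrite -kermx_eq0; apply/eqP/row_matrixP => q; rewrite row0.
  have := inj (fun j => row q (kermx M) 0 (enum_rank j)) => vz.
  apply/rowP => j; rewrite [RHS]mxE -(enum_valK j) vz// => i.
  by rewrite -mulM -row_mul mulmx_ker row0 mxE.
pose w := (\row_i b (enum_val i)) *m invmx M.
exists (fun j => w 0 (enum_rank j)) => i.
by rewrite -mulM mulmxKV ?mxE ?enum_rankK// -row_free_unit.
Qed.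

Section dirichlet_form.
Variables (R : realType) (Lambda : finType).
Implicit Types (beta : Lambda -> Lambda -> R) (k phi psi : Lambda -> R).

Definition dirichlet beta k phi psi : R :=
  2^-1 * (\sum_i \sum_j beta i j * ((phi i - phi j) * (psi i - psi j))) +
  \sum_i k i * (phi i * psi i).

Definition killed_laplacian beta k phi (i : Lambda) : R :=
  \sum_j beta i j * (phi i - phi j) + k i * phi i.

Lemma dirichletE beta k phi psi : (forall i j, beta i j = beta j i) ->
  dirichlet beta k phi psi = \sum_i psi i * killed_laplacian beta k phi i.
Proof.
move=> bsym; under [RHS]eq_bigr do rewrite mulrDr mulr_sumr.
rewrite big_split/=; congr (_ + _); last first.
  by apply: eq_bigr => i _; ring.
(* Summation by parts: exchanging [i] and [j] in one copy of [A] replaces [psi i] by [- psi j], so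
   [A + A] contains [psi i - psi j]. *)
set A := RHS; have eA : A = \sum_i \sum_j - (psi j * (beta i j * (phi i - phi j))).
  rewrite /A exchange_big/=; apply: eq_bigr => i _; apply: eq_bigr => j _.
  by rewrite (bsym j i); ring.
have : A + A = \sum_i \sum_j beta i j * ((phi i - phi j) * (psi i - psi j)).
  rewrite {1}eA -big_split/=; apply: eq_bigr => i _.
  by rewrite -big_split/=; apply: eq_bigr => j _; ring.
by move=> <-; field.
Qed.

Lemma dirichlet_ge beta k phi : (forall i j, 0 <= beta i j) ->
  \sum_i k i * phi i ^+ 2 <= dirichlet beta k phi phi.
Proof.
move=> b0; rewrite /dirichlet lerDr mulr_ge0// ?invr_ge0//.
by apply: sumr_ge0 => i _; apply: sumr_ge0 => j _; rewrite mulr_ge0// -expr2 sqr_ge0.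
Qed.

Lemma dirichletD beta k phi psi :
  dirichlet beta k (fun i => phi i + psi i) (fun i => phi i + psi i) =
  dirichlet beta k phi phi + 2 * dirichlet beta k phi psi + dirichlet beta k psi psi.
Proof.
rewrite /dirichlet; set A := \sum_i \sum_j _; set B := \sum_i k i * _.
have -> : A = \sum_i \sum_j beta i j * ((phi i - phi j) * (phi i - phi j)) +
   2 * \sum_i \sum_j beta i j * ((phi i - phi j) * (psi i - psi j)) +
   \sum_i \sum_j beta i j * ((psi i - psi j) * (psi i - psi j)).
  rewrite mulr_sumr -!big_split/=; apply: eq_bigr => i _.
  rewrite mulr_sumr -!big_split/=; apply: eq_bigr => j _; ring.
have -> : B = \sum_i k i * (phi i * phi i) + 2 * \sum_i k i * (phi i * psi i) +
    \sum_i k i * (psi i * psi i).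
  by rewrite mulr_sumr -!big_split/=; apply: eq_bigr => i _; ring.
by field.
Qed.

(* [h] is the minimiser of the killed Dirichlet form under [h a = 1], and [c]
   the minimum; the constant function [1] shows [c <= \sum_i k i]. *)
Lemma killed_harmonic beta k (a : Lambda) :
  (forall i j, beta i j = beta j i) -> (forall i j, 0 <= beta i j) ->
  (forall i, 0 < k i) ->
  exists h : Lambda -> R, exists c, [/\ h a = 1, 0 <= c, c <= \sum_i k i &
    forall i, killed_laplacian beta k h i = c * (i == a)%:R].
Proof.
move=> bsym b0 k0.
have Q0 phi : dirichlet beta k phi phi <= 0 -> forall i, phi i = 0.
  have t0 j : 0 <= k j * phi j ^+ 2 by rewrite mulr_ge0 ?sqr_ge0 ?ltW.
  move=> Qle i; suff : k i * phi i ^+ 2 == 0.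
    by rewrite mulf_eq0 gt_eqF//= sqrf_eq0 => /eqP.
  have := le_trans (dirichlet_ge k phi b0) Qle.
  rewrite (bigD1 i)//= => le0; rewrite eq_le t0 andbT.
  by apply: le_trans le0; rewrite lerDl sumr_ge0.
pose m i j := (i == j)%:R * (k i + \sum_l beta i l) - beta i j.
have mE phi i : \sum_j m i j * phi j = killed_laplacian beta k phi i.
  rewrite /m; set S := fun i => k i + \sum_l beta i l; under eq_bigr do rewrite mulrBl -/(S i).
  rewrite sumrB (bigD1 i)//= big1 ?addr0 => [|j /negbTE]; last first.
    by rewrite eq_sym => ->; rewrite !mul0r.
  rewrite eqxx mul1r /S mulrDl mulr_suml /killed_laplacian.
  under [in RHS]eq_bigr do rewrite mulrBr.
  by rewrite sumrB; ring.
(* [G] is the Green function of the killed walk with source at [a]; it gives [h = G / G a] and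
   [c = 1 / G a]. *)
have [|G GE] := solve_injective_system (m := m) (fun i => (i == a)%:R).
  move=> v v0; apply: Q0; rewrite dirichletE// big1// => i _.
  by rewrite -mE v0 mulr0.
have QG psi : dirichlet beta k G psi = psi a.
  rewrite dirichletE// (bigD1 a)//= -mE GE eqxx mulr1 big1 ?addr0// => i /negbTE ia.
  by rewrite -mE GE ia mulr0.
have Ga : 0 < G a.
  rewrite ltNge; apply/negP => Gale.
  have /Q0 G0 : dirichlet beta k G G <= 0 by rewrite QG.
  have := GE a; rewrite eqxx big1 => [/eqP|j _]; last by rewrite G0 mulr0.
  by rewrite eq_sym oner_eq0.
exists (fun i => G i / G a), (G a)^-1; split.
- by rewrite divff// gt_eqF.
- by rewrite invr_ge0 ltW.
- have <- : dirichlet beta k (fun=> 1) (fun=> 1) = \sum_i k i.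
    rewrite /dirichlet big1 ?mulr0 ?add0r => [|i _].
      by apply: eq_bigr => i _; rewrite !mulr1.
    by rewrite big1// => j _; rewrite subrr !mulr0.
  (* Write [1 = h + psi] with [psi a = 0]. The cross term is proportional to [psi a], so the form at
     [1] is [c] plus a nonnegative term. *)
  pose psi i := 1 - G i / G a.
  have -> : (fun=> 1) = (fun i => G i / G a + psi i).
    by apply/funext => i; rewrite /psi; ring.
  rewrite dirichletD.
  have scal phi : dirichlet beta k (fun i => G i / G a) phi = phi a / G a.
    rewrite -(QG phi) /dirichlet mulrDl; congr (_ + _).
      rewrite -mulrA mulr_suml; congr (_ * _); apply: eq_bigr => i _.
      by rewrite mulr_suml; apply: eq_bigr => j _; ring.
    by rewrite mulr_suml; apply: eq_bigr => i _; ring.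
  rewrite !scal /psi divff ?gt_eqF// mul1r subrr mul0r mulr0 addr0 lerDl.
  by apply: le_trans (dirichlet_ge _ _ b0); apply: sumr_ge0 => i _; rewrite mulr_ge0 ?sqr_ge0 ?ltW.
- move=> i; rewrite mulrC -GE mulr_suml -mE.
  by apply: eq_bigr => j _; rewrite mulrA.
Qed.

End dirichlet_form.

(** * The sampled walk *)

(* Expected weight collected by a chain with kernel [p], started at [y], before
   its visit number [q] to [a] (numbered from 0), over at most [m] steps: a step
   from [y] multiplies the weight by [v y]. *)
Fixpoint stopped_weight (R : realType) (Lambda : finType) (a : Lambda)
    (v : Lambda -> R) (p : Lambda -> Lambda -> R) (m : nat) (y : Lambda) (q : nat) : R :=
  match m with
  | 0 => ((y == a) && (q == 0%N))%:R
  | m'.+1 => if (y == a) && (q == 0%N) then 1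
             else v y * \sum_z p y z * stopped_weight a v p m' z (q - (y == a))
  end.

(* [h y * r ^+ q] would be exactly harmonic if [eps] were 0. *)
Lemma stopped_weight_approx (R : realType) (Lambda : finType) (a : Lambda)
    (v : Lambda -> R) (p : Lambda -> Lambda -> R) (h : Lambda -> R)
    (r rho eps C : R) (m q : nat) (y : Lambda) :
  (forall y, 0 <= v y <= rho) -> rho < 1 ->
  (forall y z, 0 <= p y z) -> (forall y, \sum_z p y z = 1) ->
  0 <= r <= 1 -> h a = 1 -> (forall y, `|h y| <= C) ->
  (forall y, `|v y * \sum_z p y z * h z - h y * r ^+ (y == a)| <= eps) ->
  `|stopped_weight a v p m y q - h y * r ^+ q| <= eps / (1 - rho) + C * rho ^+ m.
Proof.
move=> v01 rho1 p0 p1 /andP[r0 r1] ha hC heps.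
have rho0 : 0 <= rho by have /andP[v0 vr] := v01 y; exact: le_trans vr.
have C0 : 0 <= C by apply: le_trans (hC y).
have eps0 : 0 <= eps by apply: le_trans (heps y).
have B0 n : 0 <= eps / (1 - rho) + C * rho ^+ n.
  by rewrite addr_ge0 ?mulr_ge0 ?exprn_ge0// invr_ge0 subr_ge0 ltW.
elim: m y q => [|m IH] y q /=.
  case: (boolP (_ && _)) => [/andP[/eqP-> /eqP->]|_].
    by rewrite ha expr0 mulr1 subrr normr0 B0.
  rewrite sub0r normrN normrM expr0 mulr1 (ger0_norm (exprn_ge0 _ r0)).
  apply: (@le_trans _ _ C).
    rewrite -[leRHS]mulr1 ler_pM ?exprn_ge0//.
    by rewrite -[leRHS](expr1n _ q) lerXn2r ?nnegrE.
  by rewrite lerDr divr_ge0// subr_ge0 ltW.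
case: ifPn => [/andP[/eqP-> /eqP->]|nstop].
  by rewrite ha expr0 mulr1 subrr normr0 B0.
have qE : r ^+ q = r ^+ (y == a) * r ^+ (q - (y == a)).
  rewrite -exprD; congr (_ ^+ _); move: nstop; case: (y == a) => //=; lia.
set q' := (q - (y == a))%N in qE *.
(* The error after one more step is the old error, contracted by [rho], plus a fresh defect of at
   most [eps]; [eps / (1 - rho)] is the fixed point of [B |-> rho * B + eps]. *)
have -> : v y * (\sum_z p y z * stopped_weight a v p m z q') - h y * r ^+ q =
   v y * (\sum_z p y z * (stopped_weight a v p m z q' - h z * r ^+ q')) +
   r ^+ q' * (v y * (\sum_z p y z * h z) - h y * r ^+ (y == a)).
  rewrite qE; under [in RHS]eq_bigr do rewrite mulrBr.
  rewrite sumrB (_ : \sum_z p y z * (h z * _) = r ^+ q' * \sum_z p y z * h z); first ring.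
  by rewrite mulr_sumr; apply: eq_bigr => z _; ring.
apply: le_trans (ler_normD _ _) _.
set B := eps / (1 - rho) + C * rho ^+ m.
apply: (@le_trans _ _ (rho * B + eps)).
  apply: lerD.
    have /andP[v0 vr] := v01 y.
    rewrite normrM (ger0_norm v0) ler_pM//.
    apply: le_trans (ler_norm_sum _ _ _) _.
    rewrite -[leRHS]mul1r -(p1 y) mulr_suml; apply: ler_sum => z _.
    by rewrite normrM (ger0_norm (p0 _ _)) ler_wpM2l// IH.
  rewrite normrM (ger0_norm (exprn_ge0 _ r0)) -[leRHS]mul1r ler_pM ?exprn_ge0//.
  by rewrite -[leRHS](expr1n _ q') lerXn2r ?nnegrE.
rewrite /B exprS le_eqVlt; apply/orP; left; apply/eqP.
by field; rewrite gt_eqF// subr_gt0.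
Qed.

(** Pathwise counterpart of [stopped_weight]: the product of [v] along [x] before visit number [q]
    to [a], or 0 if that visit does not occur at one of the indices [0, ..., m]. *)
Fixpoint path_weight (R : realType) (Lambda : finType) (a : Lambda)
    (v : Lambda -> R) (m : nat) (x : nat -> Lambda) (q : nat) : R :=
  match m with
  | 0 => ((x 0%N == a) && (q == 0%N))%:R
  | m'.+1 => if (x 0%N == a) && (q == 0%N) then 1
    else v (x 0%N) * path_weight a v m' (fun r => x r.+1) (q - (x 0%N == a))
  end.

Lemma path_weight_01 (R : realType) (Lambda : finType) (a : Lambda)
    (v : Lambda -> R) (m q : nat) (x : nat -> Lambda) :
  (forall y, 0 <= v y <= 1) -> 0 <= path_weight a v m x q <= 1.
Proof.
move=> v01; elim: m x q => [|m IH] x q /=; first by rewrite ler0n lern1 leq_b1.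
case: ifP => _; first by rewrite ler01 lexx.
have /andP[v0 v1] := v01 (x 0%N).
have /andP[w0 w1] := IH (fun r => x r.+1) (q - (x 0%N == a))%N.
by rewrite mulr_ge0//= mulr_ile1.
Qed.

Section walk.
Context (R : realType) (Lambda : finType) (d : measure_display)
  (Omega : measurableType d) (X : R -> Omega -> Lambda).
Hypothesis mX : forall t i, 0 <= t -> measurable [set w | X t w = i].

Lemma measurable_fun_switch t (f : Lambda -> Omega -> R) : 0 <= t ->
  (forall i, measurable_fun setT (f i)) ->
  measurable_fun setT (fun w => f (X t w) w).
Proof.
move=> t0 mf.
have -> : (fun w => f (X t w) w) =
    fun w => \sum_i \1_[set w | X t w = i] w * f i w.
  apply/funext => w; rewrite (bigD1 (X t w))//= indicE mem_set//= mul1r.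
  rewrite big1 ?addr0// => i /eqP iX.
  by rewrite indicE memNset ?mul0r//= => /esym.
apply: measurable_sum => i; apply: measurable_funM => //.
by apply: measurable_indic; exact: mX.
Qed.

Lemma measurable_path_weight a (v : Lambda -> R) m q t dt : 0 <= t -> 0 <= dt ->
  measurable_fun setT (fun w => path_weight a v m (fun r => X (t + r%:R * dt) w) q).
Proof.
move=> t0 dt0; elim: m q t t0 => [|m IH] q t t0 /=.
  under eq_fun do rewrite mul0r addr0.
  exact: (@measurable_fun_switch t (fun i _ => ((i == a) && (q == 0%N))%:R)).
under eq_fun do rewrite mul0r addr0.
apply: (@measurable_fun_switch t (fun i w => if (i == a) && (q == 0%N) then 1 else
   v i * path_weight a v m (fun r => X (t + r.+1%:R * dt) w) (q - (i == a)))) => // i.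
case: (_ && _); first exact: measurable_cst.
apply: measurable_funM; first exact: measurable_cst.
rewrite (_ : (fun w => _) = fun w =>
  path_weight a v m (fun r => X ((t + dt) + r%:R * dt) w) (q - (i == a))).
  exact: IH (addr_ge0 t0 dt0).
apply/funext => w; congr path_weight; apply/funext => r.
by rewrite -addrA -[X in _ + (X + _)]mul1r -mulrDl nat1r.
Qed.

Lemma measurable_past (past : seq (R * Lambda)) :
  (forall q, q \in past -> 0 <= q.1) ->
  measurable [set w | forall q, q \in past -> X q.1 w = q.2].
Proof.
elim: past => [|q past IH] q0.
  by rewrite (_ : [set w | _] = setT)//; apply/seteqP; split.
rewrite (_ : [set w | _] = [set w | X q.1 w = q.2] `&`
    [set w | forall q, q \in past -> X q.1 w = q.2]).
  apply: measurableI; first by apply: mX; apply: q0; rewrite mem_head.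
  by apply: IH => r rp; apply: q0; rewrite inE rp orbT.
apply/seteqP; split => w /= h.
  by split=> [|r rp]; apply: h; rewrite inE ?eqxx// rp orbT.
by move=> r; rewrite inE => /predU1P[->|]; [exact: h.1|exact: h.2].
Qed.

(** The induction on [m] needs an arbitrary [past]: after splitting according to the state at time
    [t + dt], the pair [(t, y)] joins the past, and the Markov property supplies the factor
    [p dt y z]. *)
Lemma markov_path_weight (P : probability Omega R) p a (v : Lambda -> R)
    (past : seq (R * Lambda)) m q t dt y :
  transition_semigroup p -> Defs.markov p P X -> (forall y, 0 <= v y <= 1) ->
  0 <= t -> 0 <= dt -> (forall r, r \in past -> 0 <= r.1 <= t) ->
  let A := [set w | forall r, r \in past -> X r.1 w = r.2] in
  (\int[P]_(w in A `&` [set w | X t w = y])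
     (path_weight a v m (fun r => X (t + r%:R * dt) w) q)%:E =
   P (A `&` [set w | X t w = y]) * (stopped_weight a v (p dt) m y q)%:E)%E.
Proof.
move=> [p0 p1 _ _] mP v01 t0 dt0.
elim: m past q t y t0 => [|m IH] past q t y t0 tpast A /=.
all: have mA : measurable (A `&` [set w | X t w = y]) by
  apply: measurableI; [apply: measurable_past => r /tpast/andP[]|exact: mX].
  transitivity (\int[P]_(w in A `&` [set w | X t w = y])
     (((y == a) && (q == 0%N))%:R : R)%:E)%E.
    by apply: eq_integral => w /[!inE] -[_ /= <-]; rewrite mul0r addr0.
  by rewrite integral_cst// muleC.
have [ya|ya] := boolP ((y == a) && (q == 0%N)).
  transitivity (\int[P]_(w in A `&` [set w | X t w = y]) 1)%E.
    by apply: eq_integral => w /[!inE] -[_ /= Xy]; rewrite mul0r addr0 Xy ya.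
  by rewrite integral_cst// muleC.
have /andP[v0 v1] := v01 y.
pose f w := path_weight a v m (fun r => X ((t + dt) + r%:R * dt) w) (q - (y == a)).
have f0 w : 0 <= f w.
  by have /andP[] := path_weight_01 a m (q - (y == a))
    (fun r => X ((t + dt) + r%:R * dt) w) v01.
have mf : measurable_fun setT (EFin \o f).
  by apply/measurable_EFinP; apply: measurable_path_weight => //; exact: addr_ge0.
transitivity (\int[P]_(w in A `&` [set w | X t w = y]) ((v y)%:E * (f w)%:E))%E.
  apply: eq_integral => w /[!inE] -[_ /= Xy]; rewrite mul0r addr0 Xy (negbTE ya) EFinM.
  congr (_ * (path_weight _ _ _ _ _)%:E)%E; apply/funext => r.
  by rewrite -addrA -[X in _ + (X + _)]mul1r -mulrDl nat1r.
rewrite ge0_integralZl_EFin//=; last 2 first.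
- by move=> w _; rewrite lee_fin.
- by apply: measurable_funTS.
pose F z := A `&` [set w | X t w = y] `&` [set w | X (t + dt) w = z].
have mF z : measurable (F z) by apply: measurableI => //; apply: mX; exact: addr_ge0.
have FE : A `&` [set w | X t w = y] = \big[setU/set0]_(z <- index_enum Lambda) F z.
  rewrite -bigcup_seq; apply/seteqP; split => [w Aw|w [z _ []]//].
  by exists (X (t + dt) w) => //=; rewrite mem_index_enum.
rewrite [in LHS]FE ge0_integral_bigsetU//=; last 4 first.
- exact: index_enum_uniq.
- apply/trivIsetP => i j _ _ /eqP ij; apply/seteqP; split => // w.
  by move=> [[_ /= e1] [_ /= e2]]; apply: ij; rewrite -e1 -e2.
- by apply: measurable_funTS.
- by move=> w _; rewrite lee_fin.
pose past' := (t, y) :: past.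
have AE : A `&` [set w | X t w = y] = [set w | forall r, r \in past' -> X r.1 w = r.2].
  apply/seteqP; split => w /=.
    by move=> [Aw Xt] r; rewrite inE => /predU1P[->//|/Aw].
  move=> h; split; last by apply: (h (t, y)); rewrite mem_head.
  by move=> r rp; apply: h; rewrite inE rp orbT.
have step z : (\int[P]_(w in F z) (f w)%:E = P (A `&` [set w | X t w = y]) *
     (p dt y z * stopped_weight a v (p dt) m z (q - (y == a)))%:E)%E.
  rewrite /F {1}AE /f IH ?addr_ge0//; last first.
    move=> r; rewrite inE => /predU1P[->/=|/tpast/andP[-> rt]/=].
      by rewrite t0 lerDl.
    by rewrite (le_trans rt)// lerDl.
  by rewrite -AE mP// EFinM muleA.
under eq_bigr do rewrite step.
have Pfin : P (A `&` [set w | X t w = y]) \is a fin_num by exact: fin_num_measure.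
rewrite -(fineK Pfin); under eq_bigr do rewrite -EFinM.
rewrite sumEFin -!EFinM; congr EFin; rewrite mulrCA; congr (_ * _).
by rewrite mulr_sumr.
Qed.

End walk.

(** Visits are numbered from 0, so with at most [q] of them among the first [n] positions the
    stopping comes no earlier than index [n]: all [n] factors have been collected, and any further
    ones are at most 1. *)
Lemma path_weight_le_prod (R : realType) (Lambda : finType) (a : Lambda)
    (v : Lambda -> R) (m q n : nat) (x : nat -> Lambda) :
  (forall y, 0 <= v y <= 1) -> (\sum_(r < n) (x r == a) <= q)%N ->
  path_weight a v m x q <= \prod_(r < n) v (x r).
Proof.
move=> v01; elim: n m x q => [|n IH] m x q.
  by rewrite !big_ord0 => _; have /andP[] := path_weight_01 a m q x v01.
rewrite big_ord_recl/= big_ord_recl/= => xq.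
have nstop : ~~ ((x 0%N == a) && (q == 0%N)).
  by apply/negP => /andP[xa /eqP q0]; move: xq; rewrite xa q0.
have /andP[v0 _] := v01 (x 0%N).
case: m => [|m] /=; rewrite (negbTE nstop).
  by rewrite mulr_ge0// prodr_ge0// => i _; have /andP[] := v01 (x i.+1).
by rewrite ler_wpM2l// (IH m (fun r => x r.+1))// leq_subRL//; lia.
Qed.

(** Visit number [q] occurs before index [n], hence within the horizon [m]; the weight then consists
    of an initial segment of the product, whose remaining factors are at most 1. *)
Lemma path_weight_ge_prod (R : realType) (Lambda : finType) (a : Lambda)
    (v : Lambda -> R) (m q n : nat) (x : nat -> Lambda) :
  (forall y, 0 <= v y <= 1) -> (n <= m.+1)%N ->
  (q < \sum_(r < n) (x r == a))%N ->
  \prod_(r < n) v (x r) <= path_weight a v m x q.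
Proof.
move=> v01; elim: n m x q => [|n IH] m x q; first by rewrite !big_ord0.
rewrite ltnS => nm.
have [xa|nstop] := boolP ((x 0%N == a) && (q == 0%N)) => xq.
  have -> : path_weight a v m x q = 1 by case: m {nm} => [|m] /=; rewrite xa.
  by apply: prodr_ile1 => i _; exact: v01.
move: xq; rewrite big_ord_recl big_ord_recl/= => xq.
case: m nm => [|m] nm.
  move: nm xq nstop; rewrite leqn0 => /eqP->; rewrite big_ord0.
  by case: (x 0%N == a) => //=; case: q.
rewrite /= (negbTE nstop); have /andP[v0 _] := v01 (x 0%N).
rewrite ler_wpM2l// (IH m (fun r => x r.+1))//.
have {xq} : (q < (x 0%N == a) + \sum_(r < n) (x r.+1 == a))%N by [].
move: (\sum_(r < n) _)%N nstop => S.
by case: (x 0%N == a) => /=; lia.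
Qed.

Lemma cvg_rsum (R : realType) (I T : Type) (F : set_system T) (FF : Filter F)
    (r : seq I) (P : pred I) (f : I -> T -> R) (l : I -> R) :
  (forall i, P i -> f i x @[x --> F] --> l i) ->
  \sum_(i <- r | P i) f i x @[x --> F] --> \sum_(i <- r | P i) l i.
Proof. by move=> fl; apply: cvg_big => //; exact: add_continuous. Qed.

(** * Limit of the recursion as the time step tends to 0 *)

Section generator_limit.
Context (R : realType) (Lambda : finType) (beta : Lambda -> Lambda -> R)
  (p : R -> Lambda -> Lambda -> R).
Hypothesis psg : transition_semigroup p.
Hypothesis prate : has_jump_rates beta p.

Lemma cvg_harmonic_at_right : (N.+1%:R^-1 : R) @[N --> \oo] --> 0^'+.
Proof.
move=> A; rewrite /at_right /within/= => A0.
have : \forall N \near \oo, 0 < (N.+1%:R^-1 : R) -> A N.+1%:R^-1 := @cvg_harmonic R _ A0.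
by apply: filterS => N; apply; rewrite invr_gt0.
Qed.

Lemma expR_harmonic_cvg (b : R) : expR (- b / N.+1%:R) @[N --> \oo] --> (1 : R).
Proof.
suff : expR (- b / N.+1%:R) @[N --> \oo] --> expR (- b * 0) by rewrite mulr0 expR0.
apply: (cvg_comp (fun N => - b / N.+1%:R) expR); last exact: continuous_expR.
apply: cvgM; [exact: cvg_cst|exact: cvg_harmonic].
Qed.

(** Squeezed by [1 + u <= exp u <= 1 / (1 - u)] at [u = - b / N.+1]; the upper bound is
    [1 - u <= exp (- u)] inverted, valid once [u < 1]. *)
Lemma expR_slope_cvg (b : R) :
  N.+1%:R * (expR (- b / N.+1%:R) - 1) @[N --> \oo] --> - b.
Proof.
pose u N : R := - b / N.+1%:R.
have u0 : u N @[N --> \oo] --> 0.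
  suff : u N @[N --> \oo] --> - b * 0 by rewrite mulr0.
  apply: cvgM; [exact: cvg_cst|exact: cvg_harmonic].
apply: (@squeeze_cvgr _ _ _ _ (cst (- b)) (fun N => - b / (1 - u N))).
- have : \forall N \near \oo, u N < 1 by apply: (cvgr_lt 0) => //; exact: ltr01.
  apply: filterS => N uN; have N0 : 0 < N.+1%:R :> R by [].
  rewrite -/(u N); have -> : - b = N.+1%:R * u N by rewrite /u mulrC divfK// gt_eqF.
  have u1 : 0 < 1 - u N by rewrite subr_gt0.
  rewrite -mulrA !ler_pM2l//; have := expR_ge1Dx (u N) => le1.
  rewrite lerBrDl le1/= lerBlDl.
  have -> : 1 + u N / (1 - u N) = (1 - u N)^-1 by field; rewrite gt_eqF.
  by rewrite -[X in expR X]opprK expRN lef_pV2 ?posrE ?expR_gt0// expR_ge1Dx.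
- exact: cvg_cst.
- suff : - b / (1 - u N) @[N --> \oo] --> - b / (1 - 0) by rewrite subr0 divr1.
  apply: cvgM; first exact: cvg_cst.
  apply: cvgV; first by rewrite subr0 oner_neq0.
  by apply: cvgB => //; exact: cvg_cst.
Qed.

(** Jump rates are given off the diagonal only. As the rows of [p] sum to 1, subtracting [h y] turns
    [h z] into [h z - h y], and the diagonal term disappears. *)
Lemma generator_cvg (h : Lambda -> R) (y : Lambda) :
  N.+1%:R * (\sum_z p N.+1%:R^-1 y z * h z - h y) @[N --> \oo] -->
  \sum_z beta y z * (h z - h y).
Proof.
have [_ p1 _ _] := psg.
have -> : (fun N => N.+1%:R * (\sum_z p N.+1%:R^-1 y z * h z - h y)) =
    fun N => \sum_(z | z != y) (p N.+1%:R^-1 y z / N.+1%:R^-1 * (h z - h y)).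
  apply/funext => N.
  have -> : \sum_z p N.+1%:R^-1 y z * h z - h y = \sum_z p N.+1%:R^-1 y z * (h z - h y).
    under [in RHS]eq_bigr do rewrite mulrBr.
    by rewrite sumrB -mulr_suml p1 ?mul1r.
  rewrite mulr_sumr (bigD1 y)//= subrr !mulr0 add0r.
  by apply: eq_bigr => z _; rewrite invrK; ring.
have -> : \sum_z beta y z * (h z - h y) = \sum_(z | z != y) beta y z * (h z - h y).
  by rewrite (bigD1 y)//= subrr mulr0 add0r.
apply: cvg_rsum => z zy; apply: cvgM; last exact: cvg_cst.
have yz : y != z by rewrite eq_sym.
exact: (cvg_comp (fun N => N.+1%:R^-1) (fun t => p t y z / t)
  cvg_harmonic_at_right (prate yz)).
Qed.

(** To first order the defect times [N.+1] is [- k h] plus the generator applied to [h] plus [c h]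
    at [a]. Since [h a = 1], this is exactly what the equation for [h] sets to 0. *)
Lemma harmonic_defect_cvg (k h : Lambda -> R) (c : R) (a y : Lambda) : h a = 1 ->
  killed_laplacian beta k h y = c * (y == a)%:R ->
  N.+1%:R * (expR (- k y / N.+1%:R) * (\sum_z p N.+1%:R^-1 y z * h z) -
    h y * expR (- c / N.+1%:R) ^+ (y == a)) @[N --> \oo] --> 0.
Proof.
move=> ha hy; pose c' := c * (y == a)%:R.
have cE N : expR (- c / N.+1%:R) ^+ (y == a) = expR (- c' / N.+1%:R).
  by rewrite /c'; case: (y == a); rewrite ?mulr1 ?mulr0 ?oppr0 ?mul0r ?expR0.
pose B N := N.+1%:R * (\sum_z p N.+1%:R^-1 y z * h z - h y).
have -> : (fun N => N.+1%:R * (expR (- k y / N.+1%:R) * (\sum_z p N.+1%:R^-1 y z * h z) -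
    h y * expR (- c / N.+1%:R) ^+ (y == a))) =
  (fun N => h y * (N.+1%:R * (expR (- k y / N.+1%:R) - 1)) +
     expR (- k y / N.+1%:R) * B N - h y * (N.+1%:R * (expR (- c' / N.+1%:R) - 1))).
  by apply/funext => N; rewrite cE /B; ring.
have <- : h y * (- k y) + 1 * \sum_z beta y z * (h z - h y) - h y * (- c') = 0.
  have -> : h y * (- c') = - killed_laplacian beta k h y.
    by rewrite hy /c'; case: eqP => [->|_]; rewrite ?ha ?mulr1 ?mulr0 ?mul1r ?oppr0 ?mulr0.
  rewrite /killed_laplacian mul1r opprK.
  rewrite (_ : \sum_z beta y z * (h z - h y) = - \sum_j beta y j * (h y - h j)); first ring.
  by rewrite -sumrN; apply: eq_bigr => j _; ring.
apply: cvgB; last by apply: cvgM; [exact: cvg_cst|exact: expR_slope_cvg].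
apply: cvgD; first by apply: cvgM; [exact: cvg_cst|exact: expR_slope_cvg].
by apply: cvgM; [exact: expR_harmonic_cvg|exact: generator_cvg].
Qed.

Lemma truncn_div_cvg (x : R) : 0 <= x ->
  (Num.truncn (x * N.+1%:R))%:R / N.+1%:R @[N --> \oo] --> x.
Proof.
move=> x0; apply: (@squeeze_cvgr _ _ _ _ (fun N => x - N.+1%:R^-1) (cst x)).
- apply: nearW => N /=; have /andP[lo hi] := truncn_itv (mulr_ge0 x0 (ler0n R N.+1)).
  rewrite ler_pdivrMr// lo andbT ler_pdivlMr// mulrBl mulVf// lerBlDr.
  by rewrite natr1 ltW.
- suff : x - N.+1%:R^-1 @[N --> \oo] --> x - 0 by rewrite subr0.
  by apply: cvgB; [exact: cvg_cst|exact: cvg_harmonic].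
- exact: cvg_cst.
Qed.

(** The defect is [o(1 / N)] while [1 - rho] is of order [kappa / N], so their quotient vanishes.
    The horizon of [N.+1 * N.+1] steps is the time [N.+1], which grows to infinity. The
    [gamma * N.+1] visits, each with factor [exp (- c / N.+1)], produce the limit. *)
Lemma stopped_weight_cvg (k h : Lambda -> R) (c kappa gamma : R) (a : Lambda) :
  0 < kappa -> (forall i, kappa <= k i) -> h a = 1 -> 0 <= c ->
  (forall y, killed_laplacian beta k h y = c * (y == a)%:R) -> 0 <= gamma ->
  stopped_weight a (fun y => expR (- k y / N.+1%:R)) (p N.+1%:R^-1)
    (N.+1 * N.+1) a (Num.truncn (gamma * N.+1%:R)) @[N --> \oo] -->
  expR (- (c * gamma)).
Proof.
move=> kappa0 kk ha c0 hc gamma0; have [p0 p1 _ _] := psg.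
pose r N := expR (- c / N.+1%:R); pose rho N := expR (- kappa / N.+1%:R).
pose D y N := N.+1%:R * (expR (- k y / N.+1%:R) * (\sum_z p N.+1%:R^-1 y z * h z) -
    h y * r N ^+ (y == a)).
pose eps N := N.+1%:R^-1 * \sum_y `|D y N|.
pose C := \sum_y `|h y|.
pose q N := Num.truncn (gamma * N.+1%:R).
pose err N := eps N / (1 - rho N) + C * rho N ^+ (N.+1 * N.+1).
have bound N : `|stopped_weight a (fun y => expR (- k y / N.+1%:R)) (p N.+1%:R^-1)
    (N.+1 * N.+1) a (q N) - r N ^+ q N| <= err N.
  have -> : r N ^+ q N = h a * r N ^+ q N by rewrite ha mul1r.
  apply: stopped_weight_approx => //.
  - move=> y; rewrite expR_ge0 ler_expR ler_pM2r ?invr_gt0// lerN2; exact: kk.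
  - by rewrite expR_lt1 mulNr oppr_lt0 divr_gt0.
  - by move=> y z; exact: p0.
  - by move=> y; exact: p1.
  - by rewrite expR_ge0 expR_le1 mulNr oppr_le0 divr_ge0.
  - by move=> y; rewrite /C (bigD1 y)//= lerDl sumr_ge0.
  - move=> y; rewrite /eps ler_pdivlMl// -[X in X * _]ger0_norm// -normrM.
    by rewrite -/(D y N) (bigD1 y)//= lerDl sumr_ge0.
have rq : r N ^+ q N @[N --> \oo] --> expR (- (c * gamma)).
  have -> : (fun N => r N ^+ q N) = (fun N => expR (- c * ((q N)%:R / N.+1%:R))).
    apply/funext => N; rewrite /r -expRM_natl; congr expR.
    by rewrite mulrC -mulrA; congr (_ * _); rewrite mulrC.
  rewrite -mulNr; apply: (cvg_comp (fun N => - c * ((q N)%:R / N.+1%:R)) expR); last exact: continuous_expR.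
  by apply: cvgM; [exact: cvg_cst|exact: truncn_div_cvg].
have err0 : err N @[N --> \oo] --> 0.
  suff : err N @[N --> \oo] --> (\sum_(y : Lambda) `|0 : R|) * (- (- kappa))^-1 + C * 0.
    by rewrite big1 ?mul0r ?mulr0 ?addr0// => y _; rewrite normr0.
  apply: cvgD; last first.
    apply: cvgM; first exact: cvg_cst.
    (* The cut-off factor is [exp (- kappa * N.+1)], bounded through [exp (- x) <= 1 / x]. *)
    apply: (@squeeze_cvgr _ _ _ _ (cst 0) (fun N => kappa^-1 * N.+1%:R^-1)).
    - apply: nearW => N /=; rewrite exprn_ge0 ?expR_ge0//=.
      rewrite /rho -expRM_natl natrM mulrACA mulfV// mulr1 mulrN -invfM -[leLHS]invrK.
      rewrite -expRN opprK lef_pV2 ?posrE ?mulr_gt0 ?expR_gt0//.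
      by rewrite mulrC; apply: le_trans (expR_ge1Dx _); rewrite lerDr.
    - exact: cvg_cst.
    - by rewrite -(mulr0 kappa^-1); apply: cvgM; [exact: cvg_cst|exact: cvg_harmonic].
  have -> : (fun N => eps N / (1 - rho N)) =
      (fun N => (\sum_y `|D y N|) * (- (N.+1%:R * (rho N - 1)))^-1).
    apply/funext => N; rewrite /eps -mulrN opprB invfM; ring.
  apply: cvgM.
    by apply: cvg_rsum => y _; apply: cvg_norm; exact: harmonic_defect_cvg.
  apply: cvgV; first by rewrite opprK gt_eqF.
  by apply: cvgN; exact: expR_slope_cvg.
suff : r N ^+ q N + (stopped_weight a (fun y => expR (- k y / N.+1%:R)) (p N.+1%:R^-1)
    (N.+1 * N.+1) a (q N) - r N ^+ q N) @[N --> \oo] --> expR (- (c * gamma)) + 0.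
  by under eq_fun do rewrite addrC subrK; rewrite addr0.
apply: cvgD => //; apply/norm_cvg0P; apply: squeeze_cvgr err0; last exact: cvg_cst.
by apply: nearW => N /=; rewrite normr_ge0 bound.
Qed.

End generator_limit.

(** * Occupation times *)

Lemma le_bound_integrable d (T : measurableType d) (R : realType)
    (mu : {measure set T -> \bar R}) (f : T -> R) (A : set T) (M : R) :
  measurable A -> (mu A < +oo)%E -> measurable_fun A f ->
  (forall x, A x -> `|f x| <= M) -> mu.-integrable A (EFin \o f).
Proof.
move=> mA Aoo mf fM; apply: measurable_bounded_integrable => //.
exists M; split; first exact: num_real.
by move=> M' MM' x Ax /=; rewrite (le_trans (fM _ Ax))// ltW.
Qed.

(** * Riemann sums of bounded right-continuous functions *)

Section riemann_sums.
Context (R : realType) (f : R -> R) (M : R).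
Hypothesis fM : forall x, `|f x| <= M.
Hypothesis f_rc : forall x, 0 <= x -> f y @[y --> x^'+] --> f x.
Implicit Types (t x : R) (N : nat).

(* The cells are sampled at their right end points, so that right-continuity
   gives convergence everywhere. *)
Let step t N x := \sum_(r < Num.truncn (t * N.+1%:R))
  f (r.+1%:R / N.+1%:R) * \1_(`[r%:R / N.+1%:R, r.+1%:R / N.+1%:R[) x.

Let stepE t N x : 0 <= x ->
  step t N x = if (Num.truncn (x * N.+1%:R) < Num.truncn (t * N.+1%:R))%N
               then f ((Num.truncn (x * N.+1%:R)).+1%:R / N.+1%:R) else 0.
Proof.
move=> x0; set i := Num.truncn (x * N.+1%:R); rewrite /step.
have E (r : nat) : (\1_(`[r%:R / N.+1%:R, r.+1%:R / N.+1%:R[) x : R) = (i == r)%:R.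
  rewrite indicE mem_setE; congr (_ %:R).
  by rewrite in_itv/= ler_pdivrMr// ltr_pdivlMr// /i truncn_eq// mulr_ge0.
case: ifP => [iq|/negbT iq].
  rewrite (bigD1 (Ordinal iq))//= E eqxx mulr1 big1 ?addr0// => r /negbTE ri.
  rewrite E; case: eqP => [ir|]; last by rewrite mulr0.
  by move/negbT: ri => /eqP[]; apply/val_inj.
rewrite big1// => r _; rewrite E; case: eqP => [ir|]; last by rewrite mulr0.
by move: iq; rewrite ir ltn_ord.
Qed.

Let step_le t N x : 0 <= x -> `|step t N x| <= M.
Proof.
by move=> x0; rewrite stepE//; case: ifP => // _; rewrite normr0 (le_trans _ (fM 0)).
Qed.

Let step_cvg t x : 0 <= x < t -> step t N x @[N --> \oo] --> f x.
Proof.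
move=> /andP[x0 xt].
pose y N := (Num.truncn (x * N.+1%:R)).+1%:R / N.+1%:R : R.
(* The strict inequality is essential: right-continuity controls [f] only at points beyond [x]. *)
have xy N : x < y N <= x + N.+1%:R^-1.
  rewrite /y ltr_pdivlMr// truncnS_gt/= ler_pdivrMr// mulrDl mulVf// -natr1 lerD2r.
  by have /andP[] := truncn_itv (mulr_ge0 x0 (ler0n _ N.+1)).
have yx : y N @[N --> \oo] --> x.
  apply: (@squeeze_cvgr _ _ _ _ (cst x) (fun N => x + N.+1%:R^-1)); last 2 first.
  - exact: cvg_cst.
  - rewrite -[X in _ --> X]addr0; apply: cvgD; first exact: cvg_cst.
    exact: cvg_harmonic.
  by apply: nearW => N; have /andP[/ltW-> ->] := xy N.
have fy : f (y N) @[N --> \oo] --> f x.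
  by move/cvg_at_rightP: (f_rc x0); apply; split=> // N; have /andP[] := xy N.
apply: cvg_trans fy; apply: near_eq_cvg.
(* Once the mesh is below [t - x], the cell of [x] is one of the cells that the sum retains. *)
have [N0 _ N0P] : \forall N \near \oo, N.+1%:R^-1 < t - x.
  by apply: (cvgr_lt 0); [exact: cvg_harmonic|rewrite subr_gt0].
exists N0 => // N /N0P/=; rewrite invf_plt ?posrE ?subr_gt0// => Nt.
rewrite stepE//; case: ifPn => //.
case/negP; rewrite ltnNge; apply/negP; rewrite -(ler_nat R) => ji.
have /andP[lo _] := truncn_itv (mulr_ge0 x0 (ler0n R N.+1)).
have /andP[_] := truncn_itv (mulr_ge0 (ltW (le_lt_trans x0 xt)) (ler0n R N.+1)).
rewrite -[X in _ < X]natr1 => hi.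
have tx0 : 0 < t - x by rewrite subr_gt0.
have : 1 < N.+1%:R * (t - x) by rewrite -ltr_pdivrMr// mul1r.
set j := Num.truncn (t * _) in ji hi; set i := Num.truncn _ in ji lo.
move: lo hi ji; lra.
Qed.

Let mstep t N : measurable_fun setT (step t N).
Proof.
apply: measurable_sum => r; apply: measurable_funM; first exact: measurable_cst.
exact: measurable_indic.
Qed.

Lemma right_continuous_measurable t : measurable_fun `[0, t[ f.
Proof.
apply: (@measurable_fun_cvg _ _ _ _ (fun N => step t N)) => [N|x].
  exact: measurable_funTS.
by rewrite /= in_itv/=; exact: step_cvg.
Qed.

Lemma right_continuous_integrable t :
  lebesgue_measure.-integrable `[0, t] (EFin \o f).
Proof.
apply: (@le_bound_integrable _ _ _ _ _ _ M) => //.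
  by rewrite /= lebesgue_measure_itv/=; case: ifP => //; rewrite -EFinB ltry.
by apply/measurable_fun_itv_bndo_bndcP; exact: right_continuous_measurable.
Qed.

Let integral_step t N : 0 <= t -> (\int[lebesgue_measure]_(x in `[0%R, t[) (step t N x)%:E =
  (N.+1%:R^-1 * \sum_(r < Num.truncn (t * N.+1%:R)) f (r.+1%:R / N.+1%:R))%:E)%E.
Proof.
move=> t0; rewrite /step; under eq_integral do rewrite -sumEFin.
have cellE (r : nat) : (r < Num.truncn (t * N.+1%:R))%N ->
    (\int[lebesgue_measure]_(x in `[0%R, t[)
       (\1_(`[r%:R / N.+1%:R, r.+1%:R / N.+1%:R[) x)%:E = (N.+1%:R^-1 : R)%:E)%E.
  move=> rt; rewrite integral_indic// setIidl.
    rewrite /= lebesgue_measure_itv/= lte_fin ltr_pM2r ?invr_gt0// ltr_nat ltnSn.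
    by rewrite -EFinB -mulrBl -natr1 addrC addKr mul1r.
  move=> x /=; rewrite !in_itv/= => /andP[x1 x2].
  rewrite (le_trans _ x1) ?divr_ge0//= (lt_le_trans x2)// ler_pdivrMr//.
  have /andP[] := truncn_itv (mulr_ge0 t0 (ler0n R N.+1)) => + _.
  by apply: le_trans; rewrite ler_nat.
rewrite integral_sum//=; last first.
  move=> r; apply: (@le_bound_integrable _ _ _ _ _ _ M) => //.
  - by rewrite /= lebesgue_measure_itv/=; case: ifP => //; rewrite -EFinB ltry.
  - by apply: measurable_funTS; apply: measurable_funM;
      [exact: measurable_cst|exact: measurable_indic].
  - move=> x _; rewrite normrM -[leRHS]mulr1 ler_pM//.
    by rewrite indicE ger0_norm// lern1 leq_b1.
rewrite mulr_sumr -sumEFin; apply: eq_bigr => r _.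
under eq_integral do rewrite EFinM.
rewrite integralZl//; first by rewrite cellE// -EFinM mulrC.
apply: (@le_bound_integrable _ _ _ _ _ _ 1) => //.
- by rewrite /= lebesgue_measure_itv/=; case: ifP => //; rewrite -EFinB ltry.
- by move=> x _; rewrite indicE ger0_norm// lern1 leq_b1.
Qed.

Lemma riemann_sum_cvg t : 0 <= t ->
  N.+1%:R^-1 * (\sum_(r < Num.truncn (t * N.+1%:R)) f (r.+1%:R / N.+1%:R))
    @[N --> \oo] --> \int[lebesgue_measure]_(x in `[0, t]) f x.
Proof.
move=> t0; rewrite -Rintegral_itv_bndo_bndc; last first.
  apply: integrableS (right_continuous_integrable t) => //.
  by apply: subset_itvl; rewrite bnd_simp.
under eq_fun => N do rewrite -[_ * _]/(fine (_ * _)%:E) -integral_step//.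
apply: fine_cvg; rewrite fineK; last first.
  apply: integrable_fin_num => //.
  apply: integrableS (right_continuous_integrable t) => //.
  by apply: subset_itvl; rewrite bnd_simp.
apply: (@dominated_cvg _ _ _ _ _ _ _ _ (cst M%:E)) => //.
- by move=> N; apply/measurable_EFinP; apply: measurable_funTS; exact: mstep.
- move=> x /=; rewrite in_itv/= => xt; apply/fine_cvgP; split; first exact: nearW.
  exact: step_cvg.
- apply: (@le_bound_integrable _ _ _ _ (cst M) _ `|M|) => //.
  by rewrite /= lebesgue_measure_itv/=; case: ifP => //; rewrite -EFinB ltry.
- move=> N x /=; rewrite in_itv/= => /andP[x0 _].
  by rewrite lee_fin step_le.
Qed.

End riemann_sums.

Section occupation.
Context (R : realType) (Lambda : finType).
Implicit Types (x : R -> Lambda) (v : Lambda -> R).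

Definition occupation x v (t : R) : R :=
  \int[lebesgue_measure]_(r in `[0, t]) v (x r).

Definition right_cont x := forall t : R, 0 <= t -> \forall r \near t^'+, x r = x t.

Variable x : R -> Lambda.
Hypothesis xrc : right_cont x.

Let vx_le v r : `|v (x r)| <= \sum_i `|v i|.
Proof. by rewrite (bigD1 (x r))//= lerDl sumr_ge0. Qed.

Let vx_rc v t : 0 <= t -> v (x y) @[y --> t^'+] --> v (x t).
Proof.
move=> t0; apply: cvg_near_cst; apply: filterS (xrc t0) => r -> //.
Qed.

Lemma occupation_integrable v t :
  lebesgue_measure.-integrable `[0, t] (fun r => (v (x r))%:E).
Proof. exact: (@right_continuous_integrable _ (fun r => v (x r)) _ (vx_le v) (@vx_rc v)). Qed.

Lemma occupation_riemann v t : 0 <= t ->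
  N.+1%:R^-1 * (\sum_(r < Num.truncn (t * N.+1%:R)) v (x (r.+1%:R / N.+1%:R)))
    @[N --> \oo] --> occupation x v t.
Proof. exact: (@riemann_sum_cvg _ (fun r => v (x r)) _ (vx_le v) (@vx_rc v)). Qed.

(** The sampled chain starts at time 0, so its sum has one more term than the right end point sum;
    that term is [O(1 / N)]. *)
Lemma occupation_grid v t : 0 <= t ->
  N.+1%:R^-1 * (\sum_(r < (Num.truncn (t * N.+1%:R)).+1) v (x (0 + r%:R * N.+1%:R^-1)))
    @[N --> \oo] --> occupation x v t.
Proof.
move=> t0; have -> : (fun N => N.+1%:R^-1 *
     (\sum_(r < (Num.truncn (t * N.+1%:R)).+1) v (x (0 + r%:R * N.+1%:R^-1)))) =
   (fun N => N.+1%:R^-1 * v (x 0) +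
     N.+1%:R^-1 * (\sum_(r < Num.truncn (t * N.+1%:R)) v (x (r.+1%:R / N.+1%:R)))).
  apply/funext => N; rewrite big_ord_recl mulrDr/= mul0r addr0; congr (_ + _ * _).
  by apply: eq_bigr => r _; rewrite add0r.
rewrite -[occupation _ _ _]add0r; apply: cvgD; last exact: occupation_riemann.
suff : N.+1%:R^-1 * v (x 0) @[N --> \oo] --> 0 * v (x 0) by rewrite mul0r.
by apply: cvgM; [exact: cvg_harmonic|exact: cvg_cst].
Qed.

Lemma occupation_sum v t : 0 <= t ->
  occupation x v t = \sum_i v i * occupation x (fun j => (j == i)%:R) t.
Proof.
move=> t0.
have lim : N.+1%:R^-1 * (\sum_(r < Num.truncn (t * N.+1%:R)) v (x (r.+1%:R / N.+1%:R)))
    @[N --> \oo] --> \sum_i v i * occupation x (fun j => (j == i)%:R) t.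
  have -> : (fun N => N.+1%:R^-1 * (\sum_(r < Num.truncn (t * N.+1%:R)) v (x (r.+1%:R / N.+1%:R)))) =
     (fun N => \sum_i v i * (N.+1%:R^-1 *
       (\sum_(r < Num.truncn (t * N.+1%:R)) (x (r.+1%:R / N.+1%:R) == i)%:R))).
    apply/funext => N; under [in RHS]eq_bigr do rewrite mulrCA mulr_sumr.
    rewrite -mulr_sumr exchange_big/=; congr (_ * _); apply: eq_bigr => r _.
    rewrite (bigD1 (x (r.+1%:R / N.+1%:R)))//= eqxx mulr1 big1 ?addr0// => i.
    by rewrite eq_sym => /negbTE->; rewrite mulr0.
  apply: cvg_rsum => i _; apply: cvgM; first exact: cvg_cst.
  have H := @occupation_riemann (fun j => (j == i)%:R) t t0; exact: H.
have H := @occupation_riemann v t t0.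
exact: (cvg_unique _ H lim).
Qed.

Lemma occupation0 v : occupation x v 0 = 0.
Proof. by rewrite /occupation set_itv1 Rintegral_set1. Qed.

Lemma occupation_incr v (lo hi s t : R) :
  (forall i, lo <= v i <= hi) -> 0 <= s <= t ->
  lo * (t - s) <= occupation x v t - occupation x v s <= hi * (t - s).
Proof.
move=> vlh /andP[s0 st].
rewrite /occupation Rintegral_itvB ?bnd_simp//; last exact: occupation_integrable.
have I : lebesgue_measure.-integrable `]s, t] (fun r => (v (x r))%:E).
  apply: integrableS (occupation_integrable v t) => //.
  by apply: subset_itvr; rewrite bnd_simp.
have C b : b * (t - s) = \int[lebesgue_measure]_(r in `]s, t]) b.
  rewrite Rintegral_cst//= lebesgue_measure_itv/= lte_fin.
  by case: ltgtP st => // ->; rewrite subrr.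
have IC b : lebesgue_measure.-integrable `]s, t] (fun r => b%:E).
  apply: (@le_bound_integrable _ _ _ _ (cst b) _ `|b|) => //.
  by rewrite /= lebesgue_measure_itv/=; case: ifP => //; rewrite -EFinB ltry.
rewrite !C; apply/andP; split; apply: le_Rintegral => //; rewrite ?IC// => r _;
  by have /andP[] := vlh (x r).
Qed.

Lemma occupation_ge0 v t : (forall i, 0 <= v i) -> 0 <= occupation x v t.
Proof. by move=> v0; apply: Rintegral_ge0. Qed.

Lemma occupation_le v s t : (forall i, 0 <= v i) -> 0 <= s <= t ->
  occupation x v s <= occupation x v t.
Proof.
move=> v0 st; rewrite -subr_ge0.
have /(_ _ _)/andP[] := @occupation_incr v 0 (\sum_i `|v i|) s t.
- by move=> i; rewrite v0 (bigD1 i)//= ger0_norm// lerDl sumr_ge0.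
- by [].
by rewrite mul0r.
Qed.

Lemma occupation_continuous v t : (forall i, 0 <= v i) -> 0 <= t ->
  forall e, 0 < e -> exists2 dlt, 0 < dlt & forall s, 0 <= s -> `|s - t| < dlt ->
    `|occupation x v s - occupation x v t| < e.
Proof.
(* [V] is a Lipschitz constant of the occupation; the added 1 makes it positive even for [v = 0]. *)
move=> v0 t0 e e0; pose V := \sum_i `|v i| + 1.
have V0 : 0 < V by rewrite ltr_wpDl// sumr_ge0.
have vV i : 0 <= v i <= V.
  rewrite v0 /V (bigD1 i)//= ger0_norm// -addrA lerDl addr_ge0//.
  by rewrite sumr_ge0.
exists (e / V) => [|s s0]; first by rewrite divr_gt0.
rewrite ltr_pdivlMr// mulrC => se; apply: le_lt_trans se.
have [st|/ltW ts] := leP s t.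
  have /andP[] := @occupation_incr v 0 V s t vV (introT andP (conj s0 st)).
  rewrite mul0r subr_ge0 => ge0 le; rewrite distrC ger0_norm ?subr_ge0//.
  by rewrite (distrC s) ger0_norm// subr_ge0.
have /andP[] := @occupation_incr v 0 V t s vV (introT andP (conj t0 ts)).
by rewrite mul0r => ge0 le; rewrite ger0_norm// ger0_norm// subr_ge0.
Qed.

End occupation.

(** * Comparison of the sampled chain with one fixed path *)

Section sampled_weight.
Context (R : realType) (Lambda : finType) (x : R -> Lambda) (a : Lambda)
  (k : Lambda -> R).
Hypothesis xrc : right_cont x.
Hypothesis k0 : forall i, 0 <= k i.

(** A step lasts [1 / N.+1], so killing costs [k i / N.+1] per step and [gamma] units of local time
    are about [gamma * N.+1] visits. The summand [0 +] matches the start time of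
    [markov_path_weight]. *)
Definition sampled_weight (y : R -> Lambda) (gamma : R) (N : nat) : R :=
  path_weight a (fun i => expR (- k i / N.+1%:R)) (N.+1 * N.+1)
    (fun r => y (0 + r%:R * N.+1%:R^-1)) (Num.truncn (gamma * N.+1%:R)).

Let occa := occupation x (fun j => (j == a)%:R).

Let v01 N (i : Lambda) : 0 <= expR (- k i / N.+1%:R) <= 1.
Proof. by rewrite expR_ge0 expR_le1 mulNr oppr_le0 divr_ge0. Qed.

Let prod_cvg t : 0 <= t ->
  \prod_(r < (Num.truncn (t * N.+1%:R)).+1)
     expR (- k (x (0 + r%:R * N.+1%:R^-1)) / N.+1%:R) @[N --> \oo] -->
  expR (- occupation x k t).
Proof.
move=> t0; under eq_fun => N.
  rewrite -expR_sum; under eq_bigr do rewrite mulNr mulrC.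
  rewrite sumrN -mulr_sumr; over.
apply: (cvg_comp (fun N => - _) expR); last exact: continuous_expR.
by apply: cvgN; have H := @occupation_grid _ _ x xrc k t t0; exact: H.
Qed.

Let count_cvg t : 0 <= t ->
  N.+1%:R^-1 * (\sum_(r < (Num.truncn (t * N.+1%:R)).+1)
      (x (0 + r%:R * N.+1%:R^-1) == a))%N%:R @[N --> \oo] --> occa t.
Proof.
move=> t0; under eq_fun do rewrite natr_sum.
by have H := @occupation_grid _ _ x xrc (fun j => (j == a)%:R) t t0; exact: H.
Qed.

(** If the local time at [a] exceeds [gamma] by time [t], so does the sampled count for large [N]:
    the chain stops before [t] and loses at most the killing accumulated up to [t]. *)
Lemma sampled_weight_lower gamma t e : 0 <= t -> 0 <= gamma < occa t -> 0 < e ->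
  \forall N \near \oo, expR (- occupation x k t) - e <= sampled_weight x gamma N.
Proof.
move=> t0 /andP[g0 gt] e0.
have c1 : \forall N \near \oo, expR (- occupation x k t) - e <
  \prod_(r < (Num.truncn (t * N.+1%:R)).+1)
     expR (- k (x (0 + r%:R * N.+1%:R^-1)) / N.+1%:R).
  by apply: (cvgr_gt _ (prod_cvg t0)); rewrite ltrBlDr ltrDl.
have c2 : \forall N \near \oo, gamma < N.+1%:R^-1 * (\sum_(r < (Num.truncn (t * N.+1%:R)).+1)
      (x (0 + r%:R * N.+1%:R^-1) == a))%N%:R.
  exact: (cvgr_gt _ (count_cvg t0)).
(* Puts the time [t] inside the horizon [N.+1] of the sampled chain. *)
have c3 : \forall N \near \oo, t <= N.+1%:R.
  exists (Num.truncn t) => // N /= tN; apply: le_trans (ltW (truncnS_gt t)) _.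
  by rewrite ler_nat ltnS.
near=> N; apply: (@le_trans _ _ (\prod_(r < (Num.truncn (t * N.+1%:R)).+1)
     expR (- k (x (0 + r%:R * N.+1%:R^-1)) / N.+1%:R))).
  by apply: ltW; near: N; exact: c1.
apply: (@path_weight_ge_prod _ _ a (fun i => expR (- k i / N.+1%:R)) _ _
  (Num.truncn (t * N.+1%:R)).+1 (fun r => x (0 + r%:R * N.+1%:R^-1))).
- exact: v01.
- rewrite ltnS -(ler_nat R); have /andP[lo _] := truncn_itv (mulr_ge0 t0 (ler0n R N.+1)).
  by apply: le_trans lo _; rewrite natrM ler_pM2r//; near: N; exact: c3.
- rewrite truncn_lt_nat ?mulr_ge0// -ltr_pdivlMr// mulrC.
  by near: N; exact: c2.
Unshelve. all: by end_near. Qed.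

Lemma sampled_weight_upper gamma t e : 0 <= t -> occa t < gamma -> 0 < e ->
  \forall N \near \oo, sampled_weight x gamma N <= expR (- occupation x k t) + e.
Proof.
move=> t0 gt e0.
have g0 : 0 <= gamma by apply: le_trans (ltW gt); apply: occupation_ge0.
have c1 : \forall N \near \oo,
  \prod_(r < (Num.truncn (t * N.+1%:R)).+1)
     expR (- k (x (0 + r%:R * N.+1%:R^-1)) / N.+1%:R) < expR (- occupation x k t) + e.
  by apply: (cvgr_lt _ (prod_cvg t0)); rewrite ltrDl.
have c2 : \forall N \near \oo, N.+1%:R^-1 * (\sum_(r < (Num.truncn (t * N.+1%:R)).+1)
      (x (0 + r%:R * N.+1%:R^-1) == a))%N%:R < gamma.
  exact: (cvgr_lt _ (count_cvg t0)).
near=> N; apply: (@le_trans _ _ (\prod_(r < (Num.truncn (t * N.+1%:R)).+1)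
     expR (- k (x (0 + r%:R * N.+1%:R^-1)) / N.+1%:R))); last first.
  by apply: ltW; near: N; exact: c1.
apply: (@path_weight_le_prod _ _ a (fun i => expR (- k i / N.+1%:R)) _ _
  (Num.truncn (t * N.+1%:R)).+1 (fun r => x (0 + r%:R * N.+1%:R^-1))).
- exact: v01.
- rewrite truncn_ge_nat ?mulr_ge0// -ler_pdivrMr// mulrC ltW//.
  by near: N; exact: c2.
Unshelve. all: by end_near. Qed.

End sampled_weight.

Section hitting.
Context (R : realType) (Lambda : finType) (x : R -> Lambda) (a : Lambda)
  (k : Lambda -> R).
Hypothesis xrc : right_cont x.
Hypothesis k0 : forall i, 0 <= k i.

Definition hit_set (y : R -> Lambda) (gamma : R) : set R :=
  [set t | 0 <= t /\ gamma <= occupation y (fun j => (j == a)%:R) t].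

(** A path that never reaches the level gets weight 0, which is the limit of [exp (- k . L)] at
    infinite time under positive killing. The default value 0 of [inf] on the empty set would give
    weight 1 instead. *)
Definition hit_weight (y : R -> Lambda) (gamma : R) : R :=
  if `[< hit_set y gamma !=set0 >]
  then expR (- occupation y k (inf (hit_set y gamma))) else 0.

Let has_inf_hit gamma : hit_set x gamma !=set0 -> has_inf (hit_set x gamma).
Proof. by move=> n0; split => //; exists 0 => t []. Qed.

Lemma hit_time_ge0 gamma : 0 <= inf (hit_set x gamma).
Proof.
have [n0|/set0P/negP/negPn/eqP->] := pselect (hit_set x gamma !=set0); last by rewrite inf0.
by apply: lb_le_inf => // t [].
Qed.

Lemma before_hit_time gamma t : 0 <= t < inf (hit_set x gamma) ->
  occupation x (fun j => (j == a)%:R) t < gamma.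
Proof.
move=> /andP[t0 tinf]; rewrite ltNge; apply/negP => ge.
suff : inf (hit_set x gamma) <= t by rewrite leNgt tinf.
by apply: ge_inf => //; exists 0 => ? [].
Qed.

(** The occupation is continuous in time, so the level cannot be reached immediately after the
    infimum without being reached at it. *)
Lemma hit_time_mem gamma : hit_set x gamma !=set0 ->
  hit_set x gamma (inf (hit_set x gamma)).
Proof.
move=> n0; split; first exact: hit_time_ge0.
rewrite leNgt; apply/negP => lt.
have [d d0 dP] := @occupation_continuous _ _ x xrc (fun j => (j == a)%:R) _
  (fun=> ler0n _ _) (hit_time_ge0 gamma) (gamma - _) (etrans (subr_gt0 _ _) lt).
have [t [t0 gt] td] := inf_adherent d0 (has_inf_hit n0).
have it : inf (hit_set x gamma) <= t by apply: ge_inf => //; exists 0 => ? [].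
have := dP t t0; rewrite ger0_norm ?subr_ge0// ltrBlDl => /(_ td).
by move=> /(le_lt_trans (ler_norm _)); rewrite ltrD2r ltNge gt.
Qed.

(** At the hitting time the local time is known only to be at least [gamma], whereas
    [sampled_weight_lower] requires a strict excess; hence the smaller level [gamma']. *)
Lemma sampled_weight_ge_hit gamma gamma' e : 0 <= gamma' < gamma -> 0 < e ->
  \forall N \near \oo, hit_weight x gamma - e <= sampled_weight a k x gamma' N.
Proof.
move=> /andP[g0 gg] e0; rewrite /hit_weight; case: asboolP => [n0|_].
  have [t0 gt] := hit_time_mem n0.
  by apply: sampled_weight_lower => //; rewrite g0 (lt_le_trans gg).
apply: nearW => N; rewrite sub0r; apply: (@le_trans _ _ 0); first by rewrite oppr_le0 ltW.
have v01 (i : Lambda) : 0 <= expR (- k i / N.+1%:R) <= 1.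
  by rewrite expR_ge0 expR_le1 mulNr oppr_le0 divr_ge0.
by have /andP[] := path_weight_01 a (N.+1 * N.+1) (Num.truncn (gamma' * N.+1%:R))
  (fun r => x (0 + r%:R * N.+1%:R^-1)) v01.
Qed.

(** It suffices to find a time at which the level is not yet reached but the killing factor is
    already within [e / 2] of the hitting weight: just before the hitting time, or a very late time
    if the level is never reached. *)
Lemma sampled_weight_le_hit gamma kappa e : 0 < kappa ->
  (forall i, kappa <= k i) -> 0 < gamma -> 0 < e ->
  \forall N \near \oo, sampled_weight a k x gamma N <= hit_weight x gamma + e.
Proof.
move=> kappa0 kk g0 e0; have e20 : 0 < e / 2 by rewrite divr_gt0.
suff [t [t0 gt te]] : exists t, [/\ 0 <= t,
   occupation x (fun j => (j == a)%:R) t < gamma &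
   expR (- occupation x k t) <= hit_weight x gamma + e / 2].
  have := sampled_weight_upper xrc k0 t0 gt e20.
  apply: filterS => N /le_trans; apply; rewrite -lerBrDr; apply: le_trans te _.
  by rewrite lerBrDr -addrA -splitr.
rewrite /hit_weight; case: asboolP => [n0|/set0P/negP/negPn/eqP h0]; last first.
  (* The killing up to [t] is at least [kappa * t = 2 / e], and [exp (- x) <= 1 / x] bounds the
     factor by [e / 2]. *)
  pose t := (e / 2)^-1 / kappa.
  have t0 : 0 < t by rewrite divr_gt0 ?invr_gt0.
  exists t; split; first exact: ltW.
    rewrite ltNge; apply/negP => ge; have : hit_set x gamma t by split => //; exact: ltW.
    by rewrite h0.
  rewrite add0r; apply: (@le_trans _ _ (expR (- (e / 2)^-1))).
    rewrite ler_expR lerN2; have vk i : kappa <= k i <= \sum_i `|k i|.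
      by rewrite kk (bigD1 i)//= ger0_norm// lerDl sumr_ge0.
    have /andP[+ _] := occupation_incr xrc vk (introT andP (conj (lexx 0) (ltW t0))).
    by rewrite occupation0 !subr0 /t mulrC divfK ?gt_eqF.
  rewrite expRN -[leRHS]invrK lef_pV2 ?posrE ?expR_gt0 ?invr_gt0//.
  by apply: le_trans (expR_ge1Dx _); rewrite lerDr.
have [tau0 taug] := hit_time_mem n0; set tau := inf _ in tau0 taug *.
have tau_gt0 : 0 < tau.
  rewrite lt_neqAle tau0 andbT; apply/eqP => tauE.
  by move: taug; rewrite -tauE occupation0 leNgt g0.
have [d d0 dP] := occupation_continuous xrc k0 tau0 e20.
(* This choice gives [0 <= t < tau] and [tau - t < d] at once. *)
pose t := tau - Num.min tau d / 2.
have m0 : 0 < Num.min tau d by rewrite lt_min tau_gt0.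
have t0 : 0 <= t.
  rewrite subr_ge0 ler_pdivrMr// (@le_trans _ _ tau) ?ge_min ?lexx//.
  by rewrite mulr_natr mulr2n lerDl.
have tt : t < tau by rewrite ltrBlDr ltrDl divr_gt0.
exists t; split => //.
  by apply: before_hit_time; rewrite t0.
have td : `|t - tau| < d.
  rewrite /t addrAC subrr sub0r normrN ger0_norm ?divr_ge0 ?ltW//.
  rewrite ltr_pdivrMr// (@le_lt_trans _ _ d) ?ge_min ?lexx ?orbT//.
  by rewrite mulr_natr mulr2n ltrDl.
have := dP _ t0 td; rewrite ltr_norml => /andP[dA _].
have A0 := occupation_ge0 x t k0.
have At := occupation_le xrc k0 (introT andP (conj t0 (ltW tt))).
rewrite -lerBlDl; move: dA A0 At; set A := occupation x k t; set B := occupation x k tau.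
move=> dA A0 At; apply: (@le_trans _ _ (B - A)); last by move: dA; lra.
(* For [0 <= A <= B] the difference is at most [1 - exp (- (B - A)) <= B - A]. *)
have -> : expR (- A) - expR (- B) = expR (- A) * (1 - expR (- (B - A))).
  by rewrite mulrBr mulr1 -expRD; congr (_ - expR _); ring.
rewrite -[leRHS]mul1r ler_pM ?expR_ge0//.
- by rewrite subr_ge0 expR_le1 oppr_le0 subr_ge0.
- by rewrite expR_le1 oppr_le0.
- by rewrite lerBlDr -lerBlDl; have := expR_ge1Dx (- (B - A)); lra.
Qed.

End hitting.

(** * The law of the stopped local times *)

Section walk_measurability.
Context (R : realType) (Lambda : finType) (d : measure_display)
  (Omega : measurableType d) (X : R -> Omega -> Lambda) (a : Lambda).
Hypothesis mX : forall t i, 0 <= t -> measurable [set w | X t w = i].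
Hypothesis Xrc : forall w, right_cont (X^~ w).

Lemma measurable_occupation v t : 0 <= t ->
  measurable_fun setT (fun w => occupation (X^~ w) v t).
Proof.
move=> t0.
apply: (@measurable_fun_cvg _ _ _ _ (fun N w => N.+1%:R^-1 *
  (\sum_(r < Num.truncn (t * N.+1%:R)) v (X (r.+1%:R / N.+1%:R) w)))) => [N|w _].
  apply: measurable_funM; first exact: measurable_cst.
  apply: measurable_sum => r.
  apply: (@measurable_fun_switch _ _ _ _ X mX _ (fun i _ => v i)) => //.
by have H := @occupation_riemann _ _ (X^~ w) (Xrc w) v t t0; exact: H.
Qed.

Lemma measurable_set_le (f g : Omega -> R) : measurable_fun setT f ->
  measurable_fun setT g -> measurable [set w | f w <= g w].
Proof.
move=> mf mg; have := measurable_fun_ler mf mg measurableT (Y := [set true]) I.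
by rewrite setTI; congr measurable; apply/seteqP; split => w.
Qed.

Lemma measurable_set_lt (f g : Omega -> R) : measurable_fun setT f ->
  measurable_fun setT g -> measurable [set w | f w < g w].
Proof.
move=> mf mg; have := measurable_fun_ltr mf mg measurableT (Y := [set true]) I.
by rewrite setTI; congr measurable; apply/seteqP; split => w.
Qed.

Let occa t w := occupation (X^~ w) (fun j => (j == a)%:R) t.

Lemma measurable_hits (gamma : Omega -> R) : measurable_fun setT gamma ->
  measurable [set w | hit_set a (X^~ w) (gamma w) !=set0].
Proof.
move=> mg; rewrite (_ : [set w | _] = \bigcup_n [set w | gamma w <= occa n%:R w]).
  apply: bigcupT_measurable => n; apply: measurable_set_le => //.
  exact: measurable_occupation.
apply/seteqP; split => w /= [].
  move=> t [t0 gt]; exists (Num.truncn t).+1 => //=; apply: le_trans gt _.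
  by apply: occupation_le => //; rewrite t0 ltW// truncnS_gt.
by move=> n _ /= gn; exists n%:R.
Qed.

(** By monotonicity and continuity, the occupation at the hitting time is below [y] iff it is below
    [y] at some grid time where the level is already reached; this is a countable union. The level
    depends on [w] because the local times start from [L0]. *)
Lemma measurable_occupation_hit (v : Lambda -> R) (gamma : Omega -> R) :
  (forall i, 0 <= v i) -> measurable_fun setT gamma ->
  measurable_fun setT
    (fun w => occupation (X^~ w) v (inf (hit_set a (X^~ w) (gamma w)))).
Proof.
move=> v0 mg; pose E := [set w | hit_set a (X^~ w) (gamma w) !=set0].
have mE : measurable E by exact: measurable_hits.
move=> _; apply: (measurability _ (RGenInftyO.measurableE R)) => //.
move=> _ [_ [y ->] <-]; rewrite setTI.
pose q N j : R := j%:R / N.+1%:R.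
(* The first set covers paths that never reach the level: there [inf] is 0 and the occupation is
   0. *)
rewrite (_ : _ @^-1` _ = (~` E `&` [set w | 0 < y]) `|`
   \bigcup_N \bigcup_j ([set w | gamma w <= occa (q N j) w] `&`
     [set w | occupation (X^~ w) v (q N j) < y])); last first.
  apply/seteqP; split => w /=; rewrite in_itv/=.
    have [wE|nE] := pselect (E w); last first.
      rewrite (_ : hit_set _ _ _ = set0) ?inf0 ?occupation0; last by apply/eqP/negPn/negP => /set0P.
      by left.
    move=> ylt; right.
    have t0 := hit_time_ge0 (X^~ w) a (gamma w).
    have [_ gt] := hit_time_mem (Xrc w) wE.
    have [dl dl0 dlP] := occupation_continuous (Xrc w) v0 t0 (etrans (subr_gt0 _ _) ylt).
    move: t0 gt ylt dlP; set tau := inf _ => t0 gt ylt dlP.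
    have [N _ /(_ N (leqnn _))/= NP] : \forall N \near \oo, N.+1%:R^-1 < dl.
      by apply: (cvgr_lt 0); [exact: cvg_harmonic|].
    have /andP[lo hi] := truncn_itv (mulr_ge0 t0 (ler0n R N.+1)).
    (* The first grid point beyond [tau], at distance at most [1 / N.+1]. *)
    pose j := (Num.truncn (tau * N.+1%:R)).+1.
    have tq : tau <= q N j by rewrite ler_pdivlMr// ltW.
    have q0 : 0 <= q N j by exact: le_trans tq.
    exists N => //; exists j => //; split => /=.
      by apply: le_trans gt _; apply: occupation_le => //; rewrite t0.
    have qd : `|q N j - tau| < dl.
      rewrite ger0_norm ?subr_ge0//; apply: le_lt_trans NP.
      by rewrite lerBlDr ler_pdivrMr// mulrDl mulVf// /j -natr1 addrC lerD2l.
    have := dlP _ q0 qd; move=> /(le_lt_trans (ler_norm _)).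
    by rewrite ltrD2r.
  move=> [[nE y0]|[N _ [j _ [/= gq qy]]]].
    rewrite (_ : hit_set _ _ _ = set0) ?inf0 ?occupation0//.
    by apply/eqP/negPn/negP => /set0P.
  have q0 : 0 <= q N j by rewrite divr_ge0.
  apply: le_lt_trans qy; apply: occupation_le => //.
  by rewrite hit_time_ge0 ge_inf//; exists 0 => ? [].
apply: measurableU.
  by apply: measurableI; [exact: measurableC|apply: measurable_set_lt; exact: measurable_cst].
apply: bigcupT_measurable => N; apply: bigcupT_measurable => j.
have q0 : 0 <= q N j by rewrite divr_ge0.
by apply: measurableI; [apply: measurable_set_le|apply: measurable_set_lt] => //;
  exact: measurable_occupation.
Qed.

End walk_measurability.

Section probability_one.
Context (d : measure_display) (Omega : measurableType d) (R : realType)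
  (P : probability Omega R).

Lemma bounded_prob_integrable (f : Omega -> R) (M : R) :
  measurable_fun setT f -> (forall w, `|f w| <= M) -> P.-integrable setT (EFin \o f).
Proof.
move=> mf fM; apply: (@le_bound_integrable _ _ _ _ _ _ M) => //.
by rewrite [X in (X < _)%E](@probability_setT _ _ _ P) ltry.
Qed.

Lemma ae_of_prob1 (D : set Omega) (Q : Omega -> Prop) : measurable D -> P D = 1%E ->
  (forall w, D w -> Q w) -> {ae P, forall w, Q w}.
Proof.
move=> mD PD DQ; exists (~` D); split; first exact: measurableC.
  by rewrite probability_setC// PD subee.
by move=> w nQ Dw; exact/nQ/DQ.
Qed.

Lemma Rintegral_eq_prob1 (D : set Omega) (f g : Omega -> R) : measurable D ->
  P D = 1%E -> measurable_fun setT f -> measurable_fun setT g ->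
  (forall w, D w -> f w = g w) -> \int[P]_w f w = \int[P]_w g w.
Proof.
move=> mD PD mf mg fg; congr fine; apply: ae_eq_integral => //.
- exact/measurable_EFinP.
- exact/measurable_EFinP.
- by apply: (@ae_of_prob1 D) => // w Dw _; rewrite fg.
Qed.

(** The [f_ N] need not converge pointwise, they are only bounded below in the limit; but
    [min (f_ N) f] converges to [f], so dominated convergence applies to it. *)
Lemma Rintegral_le_lim (f : Omega -> R) (f_ : nat -> Omega -> R) (M l : R) :
  measurable_fun setT f -> (forall N, measurable_fun setT (f_ N)) ->
  (forall w, `|f w| <= M) -> (forall N w, `|f_ N w| <= M) ->
  (forall w e, 0 < e -> \forall N \near \oo, f w - e <= f_ N w) ->
  \int[P]_w f_ N w @[N --> \oo] --> l -> \int[P]_w f w <= l.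
Proof.
move=> mf mf_ fM f_M near fl.
have mg N : measurable_fun setT (fun w => Num.min (f_ N w) (f w)).
  exact: measurable_minr.
have gM N w : `|Num.min (f_ N w) (f w)| <= M by case: (leP (f_ N w)) => _; [exact: f_M|exact: fM].
have glim : \int[P]_w Num.min (f_ N w) (f w) @[N --> \oo] --> \int[P]_w f w.
  apply: fine_cvg; rewrite fineK; last first.
    exact/integrable_fin_num/(bounded_prob_integrable mf fM).
  apply: (@dominated_cvg _ _ _ _ _ _ _ _ (cst M%:E)) => //.
  - by move=> N; apply/measurable_EFinP; exact: mg.
  - move=> w _; apply: cvg_EFin; first exact: nearW.
    apply/cvgrPdist_le => e e0; apply: filterS (near w e e0) => N fN /=.
    case: (leP (f_ N w)) => [le|_]; last by rewrite subrr normr0 ltW.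
    by rewrite ger0_norm ?subr_ge0// lerBlDr -lerBlDl.
  - by apply: (bounded_prob_integrable (f := cst M) (M := `|M|)).
  - by move=> N w _; rewrite lee_fin.
apply: ler_cvg_to glim fl _; apply: nearW => N; apply: le_Rintegral => //.
- exact: bounded_prob_integrable (mg N) (gM N).
- exact: bounded_prob_integrable (mf_ N) (f_M N).
- by move=> w _; rewrite ge_min lexx.
Qed.

End probability_one.

(** * Laplace transform at the inverse local time, and recurrence *)

Section hitting_law.
Context (R : realType) (Lambda : finType) (d : measure_display)
  (Omega : measurableType d) (X : R -> Omega -> Lambda) (a : Lambda)
  (P : probability Omega R) (beta : Lambda -> Lambda -> R)
  (p : R -> Lambda -> Lambda -> R).
Hypothesis mX : forall t i, 0 <= t -> measurable [set w | X t w = i].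
Hypothesis Xrc : forall w, right_cont (X^~ w).
Hypothesis psg : transition_semigroup p.
Hypothesis prate : has_jump_rates beta p.
Hypothesis mP : Defs.markov p P X.
Hypothesis X0 : P [set w | X 0 w = a] = 1%E.
Variables (k h : Lambda -> R) (c kappa : R).
Hypothesis kappa0 : 0 < kappa.
Hypothesis kk : forall i, kappa <= k i.
Hypothesis ha : h a = 1.
Hypothesis c0 : 0 <= c.
Hypothesis hc : forall y, killed_laplacian beta k h y = c * (y == a)%:R.

Let k0 i : 0 <= k i. Proof. exact: le_trans (ltW kappa0) (kk i). Qed.

Let v01 N (i : Lambda) : 0 <= expR (- k i / N.+1%:R) <= 1.
Proof. by rewrite expR_ge0 expR_le1 mulNr oppr_le0 divr_ge0. Qed.

Lemma measurable_sampled_weight gamma N :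
  measurable_fun setT (fun w => sampled_weight a k (X^~ w) gamma N).
Proof. exact: (@measurable_path_weight _ _ _ _ X mX). Qed.

Lemma sampled_weight_01 (x : R -> Lambda) gamma N :
  0 <= sampled_weight a k x gamma N <= 1.
Proof. by apply: path_weight_01. Qed.

Lemma hit_weight_01 (x : R -> Lambda) gamma : 0 <= hit_weight a k x gamma <= 1.
Proof.
rewrite /hit_weight; case: asboolP => _; last by rewrite lexx ler01.
by rewrite expR_ge0 expR_le1 oppr_le0 occupation_ge0.
Qed.

Lemma measurable_hit_weight gamma :
  measurable_fun setT (fun w => hit_weight a k (X^~ w) gamma).
Proof.
rewrite /hit_weight; apply: measurable_fun_ifT.
- apply: (measurable_fun_bool true); rewrite setTI.
  rewrite (_ : _ @^-1` _ = [set w | hit_set a (X^~ w) gamma !=set0]).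
    apply: (@measurable_hits _ _ _ _ X a mX Xrc (cst gamma)); exact: measurable_cst.
  by apply/seteqP; split => w /= /asboolP.
- apply: measurableT_comp; first exact: measurable_expR.
  apply: measurable_funN.
  by apply: (@measurable_occupation_hit _ _ _ _ X a mX Xrc k (cst gamma)) => //;
    exact: measurable_cst.
- exact: measurable_cst.
Qed.

Lemma sampled_weight_mean gamma N :
  \int[P]_w sampled_weight a k (X^~ w) gamma N =
  stopped_weight a (fun y => expR (- k y / N.+1%:R)) (p N.+1%:R^-1)
    (N.+1 * N.+1) a (Num.truncn (gamma * N.+1%:R)).
Proof.
have mA : measurable [set w | X 0 w = a] by exact: mX.
have mw := measurable_sampled_weight gamma N.
pose f w := sampled_weight a k (X^~ w) gamma N.
have fE : (\int[P]_(w in [set w | X 0 w = a]) (f w)%:E = \int[P]_w (f w)%:E)%E.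
  rewrite integral_mkcond; apply: ae_eq_integral => //.
  - apply/(measurable_restrictT _ mA); apply: measurable_funTS; exact/measurable_EFinP.
  - exact/measurable_EFinP.
  - by apply: (ae_of_prob1 mA X0) => w Xw _; rewrite patchE mem_set.
rewrite /Rintegral -fE.
have i0 : 0 <= N.+1%:R^-1 :> R by [].
have past0 : forall r : R * Lambda, r \in [::] -> 0 <= r.1 <= 0 by [].
have := @markov_path_weight _ _ _ _ X mX P p a (fun y => expR (- k y / N.+1%:R)) [::]
  (N.+1 * N.+1) (Num.truncn (gamma * N.+1%:R)) 0 N.+1%:R^-1 a psg mP (v01 N) (lexx 0)
  i0 past0.
rewrite (_ : [set w | _] = setT); last by apply/seteqP; split.
by rewrite /= setTI X0 mul1e => H; rewrite [LHS](congr1 fine H).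
Qed.

Lemma hit_weight_mean gamma : 0 <= gamma ->
  \int[P]_w hit_weight a k (X^~ w) gamma = expR (- (c * gamma)).
Proof.
(* Level 0 is reached at time 0 and has weight 1; it is separate because the upper bound uses levels
   [g] with [0 <= g < gamma]. *)
rewrite le_eqVlt => /predU1P[<-|g0].
  transitivity (\int[P]_w (cst 1 w : R)).
    apply: eq_Rintegral => w _; rewrite /hit_weight.
    have h0 : hit_set a (X^~ w) 0 0 by split => //; exact: occupation_ge0.
    have n0 : hit_set a (X^~ w) 0 !=set0 by exists 0.
    rewrite asboolT// (_ : inf _ = 0) ?occupation0 ?oppr0 ?expR0//.
    apply/eqP; rewrite eq_le hit_time_ge0 andbT; apply: ge_inf => //.
    by exists 0 => ? [].
  by rewrite Rintegral_cst// mulr0 oppr0 expR0 mul1r [X in fine X](@probability_setT _ _ _ P).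
have lim g : 0 <= g -> \int[P]_w sampled_weight a k (X^~ w) g N @[N --> \oo] -->
    expR (- (c * g)).
  move=> g0'; under eq_fun do rewrite sampled_weight_mean.
  have H := stopped_weight_cvg psg prate kappa0 kk ha c0 hc g0'; exact: H.
have b01 (y : R) : 0 <= y <= 1 -> `|y| <= 1 by move=> /andP[y0 y1]; rewrite ger0_norm.
apply/eqP; rewrite eq_le; apply/andP; split.
  have le g : 0 <= g < gamma -> \int[P]_w hit_weight a k (X^~ w) gamma <= expR (- (c * g)).
    move=> /andP[g0' gg].
    apply: (@Rintegral_le_lim _ _ _ P _ (fun N w => sampled_weight a k (X^~ w) g N) 1) => //.
    - exact: measurable_hit_weight.
    - by move=> N; exact: measurable_sampled_weight.
    - by move=> w; exact/b01/hit_weight_01.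
    - by move=> N w; exact/b01/sampled_weight_01.
    - by move=> w e e0; apply: sampled_weight_ge_hit => //; rewrite g0'.
    - exact: lim.
  (* Nonnegative levels increasing to [gamma] from strictly below. *)
  have cv : expR (- (c * (gamma - gamma * N.+1%:R^-1))) @[N --> \oo] -->
      expR (- (c * (gamma - gamma * 0))).
    apply: (cvg_comp (fun N => - (c * (gamma - gamma * N.+1%:R^-1))) expR); last exact: continuous_expR.
    apply: cvgN; apply: cvgM; first exact: cvg_cst.
    apply: cvgB; first exact: cvg_cst.
    by apply: cvgM; [exact: cvg_cst|exact: cvg_harmonic].
  rewrite mulr0 subr0 in cv.
  apply: ler_cvg_to (cvg_cst _) cv _; apply: nearW => N; apply: le.
  by rewrite subr_ge0 ler_piMr ?invf_le1 ?ler1n ?ltW//= ltrBlDr ltrDl mulr_gt0.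
have intZ (f : Omega -> R) : measurable_fun setT f -> (forall w, 0 <= f w <= 1) ->
    \int[P]_w (-1 * f w) = - \int[P]_w f w.
  move=> mf f01; rewrite RintegralZl ?mulN1r//.
  by apply: (@bounded_prob_integrable _ _ _ P f 1 mf) => w; exact: b01.
(* The reverse inequality is the one-sided limit lemma applied to the negated weights. *)
rewrite -lerN2 -intZ; last 2 first.
- exact: measurable_hit_weight.
- by move=> w; exact: hit_weight_01.
apply: (@Rintegral_le_lim _ _ _ P _ (fun N w => -1 * sampled_weight a k (X^~ w) gamma N) 1).
- by apply: measurable_funM; [exact: measurable_cst|exact: measurable_hit_weight].
- by move=> N; apply: measurable_funM; [exact: measurable_cst|exact: measurable_sampled_weight].
- by move=> w; rewrite mulN1r normrN; exact/b01/hit_weight_01.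
- by move=> N w; rewrite mulN1r normrN; exact/b01/sampled_weight_01.
- move=> w e e0; have := sampled_weight_le_hit a (Xrc w) k0 kappa0 kk g0 e0.
  by apply: filterS => N; rewrite !mulN1r -opprD lerN2.
- under eq_fun => N.
    rewrite intZ; last 2 first.
    + exact: measurable_sampled_weight.
    + by move=> w; exact: sampled_weight_01.
    over.
  by apply: cvgN; apply: lim; exact: ltW.
Qed.

End hitting_law.

Section recurrence.
Context (R : realType) (Lambda : finType) (d : measure_display)
  (Omega : measurableType d) (X : R -> Omega -> Lambda) (a : Lambda)
  (P : probability Omega R) (beta : Lambda -> Lambda -> R)
  (p : R -> Lambda -> Lambda -> R).
Hypothesis bsym : forall i j, beta i j = beta j i.
Hypothesis b0 : forall i j, 0 <= beta i j.
Hypothesis mX : forall t i, 0 <= t -> measurable [set w | X t w = i].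
Hypothesis Xrc : forall w, right_cont (X^~ w).
Hypothesis psg : transition_semigroup p.
Hypothesis prate : has_jump_rates beta p.
Hypothesis mP : Defs.markov p P X.
Hypothesis X0 : P [set w | X 0 w = a] = 1%E.

(** The hitting weight is at most the indicator of reaching the level, so [exp (- c gamma)] bounds
    the probability from below. With constant killing [1 / N.+1], [c] is at most the number of
    vertices over [N.+1] and tends to 0. *)
Lemma hits_prob1 gamma : 0 <= gamma ->
  P [set w | hit_set a (X^~ w) gamma !=set0] = 1%E.
Proof.
move=> g0; set E := [set w | _].
have mE : measurable E.
  by apply: (@measurable_hits _ _ _ _ X a mX Xrc (cst gamma)); exact: measurable_cst.
have PE : P E \is a fin_num by exact: fin_num_measure.
apply/eqP; rewrite eq_le probability_le1//= -(fineK PE) lee_fin.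
pose C := (\sum_(i : Lambda) 1) * gamma : R.
have bound N : expR (- (N.+1%:R^-1 * C)) <= fine (P E).
  pose k (i : Lambda) : R := N.+1%:R^-1.
  have kpos i : 0 < k i by rewrite /k invr_gt0.
  have [h [c [ha c0 cle hc]]] := killed_harmonic a bsym b0 kpos.
  have mh := @measurable_hit_weight _ _ _ _ X a mX Xrc k _ (kpos a) (fun=> lexx _) gamma.
  have h01 w := @hit_weight_01 _ _ a k _ (kpos a) (fun=> lexx _) (X^~ w) gamma.
  have := hit_weight_mean mX Xrc psg prate mP X0 (kpos a) (fun=> lexx _) ha c0 hc g0.
  move=> hm; apply: (@le_trans _ _ (expR (- (c * gamma)))).
    rewrite ler_expR lerN2 /C mulrA ler_wpM2r//; apply: le_trans cle _.
    by rewrite mulr_sumr; apply: ler_sum => i _; rewrite mulr1.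
  rewrite -hm -[X in fine (P X)]setIT -integral_indic//; apply: le_Rintegral => //.
  - apply: (@bounded_prob_integrable _ _ _ P _ 1 mh) => w.
    by have /andP[w0 w1] := h01 w; rewrite ger0_norm.
  - apply: (@bounded_prob_integrable _ _ _ P _ 1); first exact: measurable_indic.
    by move=> w; rewrite indicE ger0_norm// lern1 leq_b1.
  - move=> w _; rewrite indicE; have /andP[w0 w1] := h01 w.
    have [wE|nE] := pselect (E w); first by rewrite mem_set.
    by rewrite memNset// /hit_weight asboolF.
have cv : expR (- (N.+1%:R^-1 * C)) @[N --> \oo] --> expR (- (0 * C)).
  apply: (cvg_comp (fun N => - (N.+1%:R^-1 * C)) expR); last exact: continuous_expR.
  by apply: cvgN; apply: cvgM; [exact: cvg_harmonic|exact: cvg_cst].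
rewrite mul0r oppr0 expR0 in cv.
by apply: (ler_cvg_to cv (cvg_cst _)); exact: nearW.
Qed.

End recurrence.

Section local_time_law.
Context (R : realType) (Lambda : finType) (beta : Lambda -> Lambda -> R)
  (d : measure_display) (Omega : measurableType d)
  (P : Lambda -> (Lambda -> R) -> probability Omega R)
  (X : R -> Omega -> Lambda) (L0 : Lambda -> Omega -> R).
Hypothesis hbeta : edge_weights beta.
Hypothesis hX : simple_random_walk beta P X L0.

Lemma walk_right_cont w : right_cont (X^~ w).
Proof. by have [_ _ sp _ _] := hX; move=> t t0; have [] := sp w t t0. Qed.

Let mX : forall t i, 0 <= t -> measurable [set w | X t w = i].
Proof. by have [] := hX. Qed.

Lemma tauE a gamma w : tau X L0 a gamma w = inf (hit_set a (X^~ w) (gamma - L0 a w)).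
Proof.
by congr inf; apply/seteqP; split => t /= [t0 le]; split => //; move: le;
  rewrite /local_time lerBlDl.
Qed.

Definition stopped_local_time a gamma w : Lambda -> R :=
  local_time X L0 (tau X L0 a gamma w) w.

Lemma stopped_local_timeE a gamma w i : stopped_local_time a gamma w i =
  L0 i w + occupation (X^~ w) (fun j => (j == i)%:R)
    (inf (hit_set a (X^~ w) (gamma - L0 a w))).
Proof. by rewrite /stopped_local_time tauE. Qed.

Lemma stopped_local_time_ge a gamma w i : L0 i w <= stopped_local_time a gamma w i.
Proof. by rewrite stopped_local_timeE lerDl occupation_ge0. Qed.

Lemma measurable_L0 i : measurable_fun setT (L0 i).
Proof. by have [] := hX. Qed.

Lemma measurable_stopped_local_time a gamma i :
  measurable_fun setT (fun w => stopped_local_time a gamma w i).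
Proof.
under eq_fun do rewrite stopped_local_timeE.
apply: measurable_funD; first exact: measurable_L0.
apply: (@measurable_occupation_hit _ _ _ _ X a mX walk_right_cont _
  (fun w => gamma - L0 a w)) => //.
apply: measurable_funB; [exact: measurable_cst|exact: measurable_L0].
Qed.

Lemma measurable_start a l : measurable [set w | X 0 w = a /\ forall j, L0 j w = l j].
Proof.
rewrite (_ : [set w | _] = [set w | X 0 w = a] `&`
    \bigcap_(j in [set: Lambda]) (L0 j @^-1` [set l j])); last first.
  by apply/seteqP; split => w [Xa Ll]; split => // j; [move=> _|]; exact: Ll.
apply: measurableI; first exact: mX.
apply: fin_bigcap_measurable => // j _.
by rewrite -[X in measurable X]setTI; apply: measurable_L0.
Qed.

Lemma start_prob1 a l : P a l [set w | X 0 w = a /\ forall j, L0 j w = l j] = 1%E.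
Proof. by have [] := hX. Qed.

(** Almost surely the walk starts as prescribed and reaches the level. There the stopped local time
    is [l] plus the occupation up to hitting [gamma - l a = gamma], so [exp (- k . l)] factors out
    of [hit_weight_mean]. *)
Lemma laplace_stopped_local_time a l gamma kappa (k h : Lambda -> R) c :
  l a = 0 -> 0 <= gamma -> 0 < kappa -> (forall i, kappa <= k i) ->
  h a = 1 -> 0 <= c ->
  (forall y, killed_laplacian beta k h y = c * (y == a)%:R) ->
  \int[P a l]_w expR (- \sum_i k i * stopped_local_time a gamma w i) =
  expR (- \sum_i k i * l i) * expR (- (c * gamma)).
Proof.
move=> la g0 kappa0 kk ha c0 hc.
have [bsym b0 _] := hbeta; have [_ _ _ _ [p [psg prate mP]]] := hX.
have k0 i : 0 <= k i by exact: le_trans (ltW kappa0) (kk i).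
have mS := measurable_start a l; have PS := start_prob1 a l.
have X0 : P a l [set w | X 0 w = a] = 1%E.
  apply/eqP; rewrite eq_le probability_le1//=; last exact: mX.
  rewrite -[X in (X <= _)%E]PS le_measure ?inE//; last by move=> w [].
  exact: mX.
pose E := [set w | hit_set a (X^~ w) gamma !=set0].
have mE : measurable E.
  by apply: (@measurable_hits _ _ _ _ X a mX walk_right_cont (cst gamma)); exact: measurable_cst.
have PE : P a l E = 1%E by exact: (hits_prob1 bsym b0 mX walk_right_cont psg prate (mP a l) X0).
have mh := @measurable_hit_weight _ _ _ _ X a mX walk_right_cont k _ kappa0 kk gamma.
have h01 w := @hit_weight_01 _ _ a k _ kappa0 kk (X^~ w) gamma.
have <- := hit_weight_mean mX walk_right_cont psg prate (mP a l) X0 kappa0 kk ha c0 hc g0.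
rewrite -RintegralZl//; last first.
  apply: (@bounded_prob_integrable _ _ _ (P a l) _ 1 mh) => w.
  by have /andP[w0 w1] := h01 w; rewrite ger0_norm.
apply: (@Rintegral_eq_prob1 _ _ _ _ ([set w | X 0 w = a /\ forall j, L0 j w = l j] `&` E)).
- exact: measurableI.
- have PSC : P a l (~` [set w | X 0 w = a /\ (forall j : Lambda, L0 j w = l j)]) = 0%E.
    by rewrite probability_setC// PS subee.
  have PEC : P a l (~` E) = 0%E by rewrite probability_setC// PE subee.
  apply/eqP; rewrite -[_ `&` _]setCK probability_setC; last first.
    by apply: measurableC; exact: measurableI.
  rewrite setCI (_ : P a l _ = 0%E) ?sube0//.
  apply/negligibleP; first by apply: measurableU; exact: measurableC.
  by apply: negligibleU; apply/negligibleP => //; exact: measurableC.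
- apply: measurableT_comp; first exact: measurable_expR.
  apply: measurable_funN; apply: measurable_sum => i.
  by apply: measurable_funM; [exact: measurable_cst|exact: measurable_stopped_local_time].
- by apply: measurable_funM; [exact: measurable_cst|exact: mh].
- move=> w [[Xa Ll] Ew]; rewrite /hit_weight asboolT// -expRD; congr expR.
  rewrite -opprD (occupation_sum (walk_right_cont w)) ?hit_time_ge0// -big_split/=.
  congr (- _); apply: eq_bigr => i _.
  by rewrite stopped_local_timeE Ll Ll la subr0 mulrDr.
Qed.

End local_time_law.

(** * Approximation by exponential sums *)

Section bernstein.
Context (R : realType) (Lambda : finType).
Implicit Types (x y : Lambda -> R) (f : (Lambda -> nat) -> R).

(* Mean of [f] over the sum of [N] independent vectors of independent Bernoulli
   variables with parameters [x i]; for [f] a sampled function this is the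
   multivariate Bernstein polynomial. *)
Fixpoint bernoulli_mean (N : nat) f x : R :=
  match N with
  | 0 => f (fun=> 0%N)
  | N'.+1 => \sum_(e : {ffun Lambda -> bool})
      (\prod_i (if e i then x i else 1 - x i)) *
      bernoulli_mean N' (fun kap => f (fun i => (kap i + e i)%N)) x
  end.

Let weight x (e : {ffun Lambda -> bool}) := \prod_i (if e i then x i else 1 - x i).

Let sum_weight_marginal x i (phi : bool -> R) :
  \sum_e weight x e * phi (e i) = x i * phi true + (1 - x i) * phi false.
Proof.
(* Placing [phi] in the factor of coordinate [i] makes the summand a product, so the sum over all
   [e] factorises. *)
pose F j (b : bool) := (if b then x j else 1 - x j) * (if j == i then phi b else 1).
transitivity (\sum_(e : {ffun Lambda -> bool}) \prod_j F j (e j)).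
  apply: eq_bigr => e _; rewrite /F big_split/=; congr (_ * _).
  by rewrite (bigD1 i)//= eqxx big1 ?mulr1// => j /negbTE->.
rewrite -bigA_distr_bigA/= (bigD1 i)//= big_bool /F eqxx/= big1 ?mulr1//.
by move=> j /negbTE ->; rewrite big_bool/= !mulr1 addrC subrK.
Qed.

Let sum_weight x : \sum_e weight x e = 1.
Proof.
rewrite /weight -(bigA_distr_bigA (fun j (b : bool) => if b then x j else 1 - x j))/=.
by rewrite big1// => j _; rewrite big_bool/= addrC subrK.
Qed.

Variable x : Lambda -> R.
Hypothesis x01 : forall i, 0 <= x i <= 1.

Let weight_ge0 e : 0 <= weight x e.
Proof.
apply: prodr_ge0 => i _; have /andP[x0 x1] := x01 i.
by case: (e i) => //; rewrite subr_ge0.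
Qed.

Lemma bernoulli_mean_le N f1 f2 : (forall kap, f1 kap <= f2 kap) ->
  bernoulli_mean N f1 x <= bernoulli_mean N f2 x.
Proof.
elim: N f1 f2 => [|N IH] f1 f2 f12 //=; apply: ler_sum => e _.
by rewrite ler_wpM2l ?weight_ge0// IH.
Qed.

Lemma bernoulli_meanD N f1 f2 : bernoulli_mean N (fun kap => f1 kap + f2 kap) x =
  bernoulli_mean N f1 x + bernoulli_mean N f2 x.
Proof.
elim: N f1 f2 => [|N IH] f1 f2 //=; rewrite -big_split/=.
by apply: eq_bigr => e _; rewrite IH mulrDr.
Qed.

Lemma bernoulli_meanZ N c f : bernoulli_mean N (fun kap => c * f kap) x =
  c * bernoulli_mean N f x.
Proof.
elim: N f => [|N IH] f //=; rewrite mulr_sumr.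
by apply: eq_bigr => e _; rewrite IH mulrCA.
Qed.

Lemma bernoulli_mean_cst N c : bernoulli_mean N (fun=> c) x = c.
Proof.
elim: N => [|N IH] //=; under eq_bigr do rewrite IH.
by rewrite -mulr_suml sum_weight mul1r.
Qed.

Lemma bernoulli_mean_sum N (F : Lambda -> (Lambda -> nat) -> R) :
  bernoulli_mean N (fun kap => \sum_i F i kap) x = \sum_i bernoulli_mean N (F i) x.
Proof.
elim: N F => [|N IH] F //=; rewrite exchange_big/=.
by apply: eq_bigr => e _; rewrite IH mulr_sumr.
Qed.

(** The offset [u] is there for the induction: peeling off one Bernoulli vector replaces [u] by
    [u + e i - x i], whose mean square is [u ^+ 2 + x i * (1 - x i)]. *)
Lemma bernoulli_mean_variance N i (u : R) :
  bernoulli_mean N (fun kap => ((kap i)%:R + u - N%:R * x i) ^+ 2) x =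
  N%:R * (x i * (1 - x i)) + u ^+ 2.
Proof.
elim: N u => [|N IH] u /=; first by rewrite add0r !mul0r subr0 add0r.
transitivity (\sum_(e : {ffun Lambda -> bool}) weight x e *
    (N%:R * (x i * (1 - x i)) + (u + (e i)%:R - x i) ^+ 2)).
  apply: eq_bigr => e _; congr (_ * _); rewrite -IH; congr bernoulli_mean.
  by apply/funext => kap; rewrite natrD -natr1; congr (_ ^+ 2); ring.
rewrite (sum_weight_marginal x i (fun b => N%:R * (x i * (1 - x i)) + (u + b%:R - x i) ^+ 2)).
by rewrite -natr1/=; ring.
Qed.

Lemma bernoulli_mean_bound N f M : (forall kap, `|f kap| <= M) ->
  `|bernoulli_mean N f x| <= M.
Proof.
move=> fM; rewrite ler_norml -{1}(bernoulli_mean_cst N (- M)) -{2}(bernoulli_mean_cst N M).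
by apply/andP; split; apply: bernoulli_mean_le => kap; have := fM kap; rewrite ler_norml => /andP[].
Qed.

(** Chebyshev's argument in pointwise form: the increment of [G] is at most [e / 2] near [x], and
    far from [x] at most [2 * M], which [2 * M / dlt ^+ 2] times the squared distance dominates. The
    mean of the latter is [O(1 / N)]. *)
Lemma bernstein_cvg (G : (Lambda -> R) -> R) (M : R) :
  (forall y, `|G y| <= M) ->
  (forall e, 0 < e -> exists2 dlt, 0 < dlt & forall y, (forall i, `|y i - x i| < dlt) ->
     `|G y - G x| <= e) ->
  bernoulli_mean N.+1 (fun kap => G (fun i => (kap i)%:R / N.+1%:R)) x
    @[N --> \oo] --> G x.
Proof.
move=> GM Gc; apply/cvgrPdist_le => e e0.
have e20 : 0 < e / 2 by rewrite divr_gt0.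
have [dlt d0 dG] := Gc _ e20.
have M0 : 0 <= M by apply: le_trans (GM x).
pose B := 2 * M / dlt ^+ 2.
have B0 : 0 <= B by rewrite divr_ge0 ?mulr_ge0 ?exprn_ge0// ltW.
pose S := \sum_i x i * (1 - x i).
have cv : B * S * N.+1%:R^-1 @[N --> \oo] --> B * S * 0.
  by apply: cvgM; [exact: cvg_cst|exact: cvg_harmonic].
rewrite mulr0 in cv.
have : \forall N \near \oo, B * S * N.+1%:R^-1 < e / 2 by exact: (cvgr_lt 0 cv).
apply: filterS => N NP.
have N0 : N.+1%:R != 0 :> R by [].
have bound kap : `|G x - G (fun i => (kap i)%:R / N.+1%:R)| <=
    e / 2 + B * N.+1%:R ^- 2 * \sum_i ((kap i)%:R + 0 - N.+1%:R * x i) ^+ 2.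
  have sum0 : 0 <= \sum_i ((kap i)%:R + 0 - N.+1%:R * x i) ^+ 2.
    by apply: sumr_ge0 => i _; exact: sqr_ge0.
  have [near|/existsNP[i /negP]] := pselect (forall i, `|(kap i)%:R / N.+1%:R - x i| < dlt).
    rewrite distrC; apply: le_trans (dG _ near) _; rewrite lerDl.
    by apply: mulr_ge0 => //; apply: mulr_ge0 => //; rewrite invr_ge0 exprn_ge0.
  rewrite -leNgt => far; apply: (@le_trans _ _ (2 * M)).
    by apply: le_trans (ler_normB _ _) _; rewrite mulr_natl mulr2n lerD.
  apply: ler_wpDl; first exact: ltW.
  move: sum0; set S2 := \sum_i _ => sum0.
  have S2ge : (dlt * N.+1%:R) ^+ 2 <= S2.
    apply: (@le_trans _ _ (((kap i)%:R + 0 - N.+1%:R * x i) ^+ 2)); last first.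
      by rewrite /S2 (bigD1 i)//= lerDl sumr_ge0// => j _; exact: sqr_ge0.
    have -> : (kap i)%:R + 0 - N.+1%:R * x i = N.+1%:R * ((kap i)%:R / N.+1%:R - x i).
      by field.
    rewrite -[leRHS]real_normK ?num_real// normrM ger0_norm// mulrC.
    rewrite lerXn2r ?nnegrE ?mulr_ge0 ?normr_ge0 ?(ltW d0)//.
    by rewrite ler_wpM2l.
  have -> : B * N.+1%:R ^- 2 * S2 = 2 * M * (S2 / (dlt * N.+1%:R) ^+ 2).
    rewrite /B; move: (N.+1%:R : R) N0 => nu nu0.
    by field; rewrite nu0 gt_eqF.
  by rewrite ler_peMr ?mulr_ge0// ler_pdivlMr ?mul1r// exprn_gt0// mulr_gt0.
have -> : G x - bernoulli_mean N.+1 (fun kap => G (fun i => (kap i)%:R / N.+1%:R)) x =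
    bernoulli_mean N.+1 (fun kap => G x + -1 * G (fun i => (kap i)%:R / N.+1%:R)) x.
  by rewrite bernoulli_meanD bernoulli_mean_cst bernoulli_meanZ mulN1r.
set Z := bernoulli_mean _ _ _.
suff : `|Z| <= e / 2 + B * N.+1%:R ^- 2 * \sum_i (N.+1%:R * (x i * (1 - x i)) + 0 ^+ 2).
  move/le_trans; apply; rewrite [leRHS]splitr lerD2l ltW//; move: NP.
  under eq_bigr do rewrite expr0n addr0.
  rewrite -mulr_sumr -/S; move: (N.+1%:R : R) N0 => nu nu0.
  by congr (_ < _); field.
have -> : e / 2 + B * N.+1%:R ^- 2 * \sum_i (N.+1%:R * (x i * (1 - x i)) + 0 ^+ 2) =
   bernoulli_mean N.+1 (fun kap => e / 2 + B * N.+1%:R ^- 2 *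
      \sum_i ((kap i)%:R + 0 - N.+1%:R * x i) ^+ 2) x.
  rewrite bernoulli_meanD bernoulli_mean_cst bernoulli_meanZ; congr (_ + _ * _).
  rewrite (bernoulli_mean_sum _ (fun i kap => ((kap i)%:R + 0 - N.+1%:R * x i) ^+ 2)).
  by apply: eq_bigr => i _; rewrite bernoulli_mean_variance.
rewrite ler_norml; apply/andP; split.
  rewrite lerNl -mulN1r -bernoulli_meanZ; apply: bernoulli_mean_le => kap.
  apply: le_trans (bound kap); rewrite !mulN1r lerNl.
  by have := ler_norm (- (G x - G (fun i => (kap i)%:R / N.+1%:R))); rewrite normrN; lra.
by apply: bernoulli_mean_le => kap; apply: le_trans (bound kap); rewrite mulN1r ler_norm.
Qed.

End bernstein.

Section exponential_sums.
Context (R : realType) (Lambda : finType).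
Implicit Types (x l : Lambda -> R) (s : seq (R * (Lambda -> nat))).

Definition monomial_sum s x : R := \sum_(t <- s) t.1 * \prod_i x i ^+ t.2 i.

(** The exponents start at 2: this is [monomial_sum] at [exp (- l i)] times the decay factor
    [exp (- 2 \sum_i l i)]. *)
Definition exp_sum s l : R :=
  \sum_(t <- s) t.1 * expR (- \sum_i (t.2 i).+2%:R * l i).

Lemma exp_sumE s l : exp_sum s l =
  \prod_i expR (- l i) ^+ 2 * monomial_sum s (fun i => expR (- l i)).
Proof.
rewrite /monomial_sum mulr_sumr; apply: eq_bigr => t _.
rewrite mulrCA; congr (_ * _); rewrite -big_split/= -sumrN expR_sum.
by apply: eq_bigr => i _; rewrite -exprD -expRM_natl mulrN.
Qed.

Lemma bernoulli_mean_monomials N (f : (Lambda -> nat) -> R) :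
  exists s, forall x, bernoulli_mean N f x = monomial_sum s x.
Proof.
(* The monomial sums contain the constants and are closed under sums, scalars and multiplication by
   a coordinate; the recursion of [bernoulli_mean] uses nothing else. *)
pose poly (phi : (Lambda -> R) -> R) := exists s, forall x, phi x = monomial_sum s x.
have pcst c : poly (fun=> c).
  exists [:: (c, fun=> 0%N)] => x; rewrite /monomial_sum big_seq1/= big1 ?mulr1// => i _.
have padd phi psi : poly phi -> poly psi -> poly (fun x => phi x + psi x).
  move=> [s1 e1] [s2 e2]; exists (s1 ++ s2) => x.
  by rewrite /monomial_sum big_cat e1 e2.
have pscale c phi : poly phi -> poly (fun x => c * phi x).
  move=> [s e]; exists [seq (c * t.1, t.2) | t <- s] => x.
  by rewrite /monomial_sum big_map e mulr_sumr; apply: eq_bigr => t _ /=; rewrite mulrA.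
have pX i phi : poly phi -> poly (fun x => x i * phi x).
  move=> [s e]; exists [seq (t.1, fun j => (t.2 j + (j == i))%N) | t <- s] => x.
  rewrite /monomial_sum big_map e mulr_sumr; apply: eq_bigr => t _ /=.
  rewrite mulrCA; congr (_ * _); rewrite (bigD1 i)//= [in RHS](bigD1 i)//= eqxx addn1 exprS mulrA.
  by congr (_ * _); apply: eq_bigr => j /negbTE->; rewrite addn0.
have psum (I : Type) (r : seq I) (F : I -> (Lambda -> R) -> R) :
    (forall i, poly (F i)) -> poly (fun x => \sum_(i <- r) F i x).
  move=> pF; elim: r => [|i r IH].
    by rewrite (_ : (fun x => _) = fun=> 0); [exact: pcst|apply/funext => x; rewrite big_nil].
  rewrite (_ : (fun x => _) = fun x => F i x + \sum_(j <- r) F j x); first exact: padd.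
  by apply/funext => x; rewrite big_cons.
have pweight (r : seq Lambda) (e : {ffun Lambda -> bool}) phi : poly phi ->
    poly (fun x => (\prod_(i <- r) (if e i then x i else 1 - x i)) * phi x).
  move=> pphi; elim: r => [|i r IH].
    by rewrite (_ : (fun x => _) = phi)//; apply/funext => x; rewrite big_nil mul1r.
  pose psi x := (\prod_(i <- r) (if e i then x i else 1 - x i)) * phi x.
  rewrite (_ : (fun x => _) = if e i then (fun x => x i * psi x) else
      (fun x => psi x + -1 * (x i * psi x))).
    by case: (e i); [exact: pX|apply: padd => //; apply: pscale; exact: pX].
  by apply/funext => x; rewrite big_cons /psi; case: (e i); ring.
elim: N f => [|N IH] f /=; first exact: pcst.
by apply: psum => e; apply: pweight; exact: IH.
Qed.

(** Sequential form with coordinatewise convergence, which dominated convergence can use without a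
    topology on the function type. *)
Definition seq_continuous (g : (Lambda -> R) -> R) : Prop :=
  forall (y : nat -> Lambda -> R) l, (forall i, y N i @[N --> \oo] --> l i) ->
    g (y N) @[N --> \oo] --> g l.

(* In the variables [x i = expR (- l i)] exponential sums are polynomials; the
   factor [\prod_i x i ^+ 2] split off before applying the Bernstein approximation
   provides the exponential decay. *)
Lemma exp_sum_approx (g : (Lambda -> R) -> R) (M : R) : seq_continuous g ->
  (forall l, (forall i, 0 <= l i) -> `|g l| * expR (2 * \sum_i l i) <= M) ->
  exists s : nat -> seq (R * (Lambda -> nat)), forall l, (forall i, 0 <= l i) ->
    (forall N, `|exp_sum (s N) l| <= M * expR (- (2 * \sum_i l i))) /\
    exp_sum (s N) l @[N --> \oo] --> g l.
Proof.
move=> gc gM.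
(* Inverse of [l |-> exp (- l)], clipped at 0 because the bound on [g] is assumed for nonnegative
   arguments only; Bernstein's theorem needs [G] bounded everywhere. *)
pose lg (y : Lambda -> R) i : R := Num.max 0 (- ln (y i)).
have lg0 y i : 0 <= lg y i by rewrite le_max lexx.
pose H (l : Lambda -> R) := g l * expR (2 * \sum_i l i).
pose G y := if [forall i, 0 < y i] then H (lg y) else 0 : R.
have M0 : 0 <= M by apply: le_trans (gM (fun=> 0) _) => //; rewrite mulr_ge0 ?expR_ge0.
have GM y : `|G y| <= M.
  rewrite /G; case: ifP => _; last by rewrite normr0.
  by rewrite /H normrM (ger0_norm (expR_ge0 _)) gM.
have Gc x : (forall i, 0 < x i <= 1) -> forall e, 0 < e -> exists2 dlt, 0 < dlt &
    forall y, (forall i, `|y i - x i| < dlt) -> `|G y - G x| <= e.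
  (* If no [dlt] worked, choosing a bad point within each [1 / N.+1] would give a sequence
     contradicting [seq_continuous]. *)
  move=> x01 e e0; apply: contrapT => nd.
  have /choice[y yP] : forall N : nat, exists y, (forall i, `|y i - x i| < N.+1%:R^-1) /\
      ~ (`|G y - G x| <= e).
    move=> N; apply: contrapT => ny; apply: nd; exists N.+1%:R^-1; first by rewrite invr_gt0.
    by move=> y yx; apply: contrapT => nG; apply: ny; exists y.
  have yx i : y N i @[N --> \oo] --> x i.
    apply/cvgrPdist_le => d d0.
    have : \forall N \near \oo, N.+1%:R^-1 < d by exact: (cvgr_lt 0 (@cvg_harmonic R)).
    apply: filterS => N /ltW; apply: le_trans.
    by rewrite distrC ltW//; have [] := yP N.
  have ypos : \forall N \near \oo, [forall i, 0 < y N i].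
    (* As all [x i] are at most 1, their product is a positive lower bound for each of them. *)
    have p0 : 0 < \prod_i x i by apply: prodr_gt0 => i _; have /andP[] := x01 i.
    have : \forall N \near \oo, N.+1%:R^-1 < \prod_i x i.
      exact: (cvgr_lt 0 (@cvg_harmonic R)).
    apply: filterS => N Np.
    apply/forallP => i; have [/(_ i) + _] := yP N.
    move=> /lt_trans /(_ Np); rewrite distrC => /(le_lt_trans (ler_norm _)).
    have : \prod_i x i <= x i.
      rewrite (bigD1 i)//= ler_piMr//; first by have /andP[/ltW] := x01 i.
      by apply: prodr_ile1 => j _; have /andP[/ltW-> ->] := x01 j.
    by move=> h1 h2; move: (lt_le_trans h2 h1); rewrite ltrBlDr ltrDl.
  have Gx : G x = H (lg x).
    by rewrite /G ifT//; apply/forallP => i; have /andP[] := x01 i.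
  have lgc i : lg (y N) i @[N --> \oo] --> lg x i.
    have lnc : ln (y N i) @[N --> \oo] --> ln (x i).
      apply: (cvg_comp (fun N => y N i) (@ln R) (yx i)); apply: continuous_ln.
      by have /andP[] := x01 i.
    rewrite /lg maxr_absE; under eq_fun do rewrite maxr_absE.
    apply: cvgM; last exact: cvg_cst.
    apply: cvgD; first by apply: cvgD; [exact: cvg_cst|exact: cvgN].
    by apply: cvg_norm; apply: cvgB; [exact: cvg_cst|exact: cvgN].
  have Hc : H (lg (y N)) @[N --> \oo] --> H (lg x).
    apply: cvgM; first exact: gc.
    apply: (cvg_comp (fun N => 2 * \sum_i lg (y N) i) expR); last exact: continuous_expR.
    by apply: cvgM; [exact: cvg_cst|apply: cvg_rsum => i _].
  have : \forall N \near \oo, `|G (y N) - G x| <= e.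
    move/cvgrPdist_le : Hc => /(_ e e0); apply: filterS2 ypos => N yN.
    by rewrite distrC Gx /G yN.
  move=> [N _ /(_ N (leqnn N))/=]; by have [] := yP N.
have /choice[s sP] : forall N, exists s, forall x,
    bernoulli_mean N.+1 (fun kap => G (fun i => (kap i)%:R / N.+1%:R)) x = monomial_sum s x.
  by move=> N; exact: bernoulli_mean_monomials.
exists s => l l0; pose x i := expR (- l i).
have x01 i : 0 < x i <= 1 by rewrite expR_gt0 expR_le1 oppr_le0 l0.
have x01' i : 0 <= x i <= 1 by have /andP[/ltW-> ->] := x01 i.
have xl : \prod_i x i ^+ 2 = expR (- (2 * \sum_i l i)).
  by rewrite prodrXl -expR_sum sumrN -expRM_natl mulrN.
split=> [N|].
  rewrite exp_sumE -/x xl -sP normrM (ger0_norm (expR_ge0 _)) mulrC.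
  by rewrite ler_wpM2r ?expR_ge0// bernoulli_mean_bound.
have -> : g l = expR (- (2 * \sum_i l i)) * G x.
  have lx : lg x = l.
    by apply/funext => i; rewrite /lg /x expRK opprK; apply/max_idPr.
  rewrite /G ifT; last by apply/forallP => i; have /andP[] := x01 i.
  by rewrite lx /H mulrCA -expRD addNr expR0 mulr1.
under eq_fun do rewrite exp_sumE -/x xl -sP.
apply: cvgM; first exact: cvg_cst.
apply: bernstein_cvg => //.
exact: Gc.
Qed.

End exponential_sums.

Section test_function_bounds.
Context (R : realType) (Lambda : finType).
Implicit Types (g : {ptws Lambda -> R} -> R).

Lemma continuous_seq_continuous g : continuous g -> seq_continuous g.
Proof.
move=> gc y l yl; apply: (cvg_comp (fun N => y N : {ptws Lambda -> R}) g); last exact: gc.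
have := @pointwise_cvgP (discrete_topology Lambda) R (y @ \oo) l _.
by move=> H; apply/H.
Qed.

(** Coordinates are bounded on the compact support, hence so is the exponential weight; the constant
    [M * (1 + expR _)] serves both bounds. *)
Lemma compactly_supported_bound g : continuous g -> compactly_supported g ->
  exists M, (forall l, `|g l| <= M) /\
    forall l : {ptws Lambda -> R}, `|g l| * expR (2 * \sum_i l i) <= M.
Proof.
rewrite /compactly_supported; set K := closure _ => gc cK.
have bnd (f : {ptws Lambda -> R} -> R) : continuous f ->
    exists M, 0 <= M /\ forall l, K l -> `|f l| <= M.
  move=> fc; have cfK := continuous_compact (continuous_subspaceT fc) cK.
  have [M [_ MP]] := compact_bounded cfK.
  exists (`|M| + 1); split; first by rewrite addr_ge0.
  move=> l Kl; apply: (MP (`|M| + 1)); last by exists l.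
  by rewrite (le_lt_trans (ler_norm M))// ltrDl.
have [M [M0 gM]] := bnd g gc.
have /choice[B BP] : forall i : Lambda, exists B, 0 <= B /\ forall l, K l -> `|l i| <= B.
  move=> i; have [B [B0 BP]] := bnd (proj i) (@proj_continuous Lambda (fun=> R) i).
  by exists B; split => // l /BP.
exists (M * (1 + expR (2 * \sum_i B i))).
have e0 : 0 <= expR (2 * \sum_i B i) by exact: expR_ge0.
have Kg l : g l != 0 -> K l by move=> gl; exact: subset_closure.
split=> l; have [->|/Kg Kl] := eqVneq (g l) 0; rewrite ?normr0 ?mul0r ?mulr_ge0 ?addr_ge0//.
  by rewrite -[leLHS]mulr1 ler_pM ?gM// lerDl.
rewrite ler_pM ?expR_ge0 ?gM// ler_wpDl// ler_expR ler_pM2l//; apply: ler_sum => i _.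
by apply: le_trans (ler_norm _) _; have [_] := BP i; exact.
Qed.

End test_function_bounds.

(** * The Gaussian side *)

Section lebesgue_translation.
Context (R : realType).
Local Open Scope ereal_scope.

Lemma measurable_shift (v : R) : measurable_fun [set: R] (fun x => x + v)%R.
Proof. exact: measurable_funD. Qed.

(** The image of Lebesgue measure under a translation gives intervals the same length, so it is
    Lebesgue measure by uniqueness. *)
Lemma ge0_integral_shift (v : R) (f : R -> \bar R) : measurable_fun setT f ->
  (forall x, 0 <= f x) ->
  \int[lebesgue_measure]_x f (x + v)%R = \int[lebesgue_measure]_x f x.
Proof.
move=> mf f0.
rewrite -(@ge0_integral_pushforward _ _ (measurableTypeR R) (measurableTypeR R) R _
  (measurable_shift v) lebesgue_measure setT f)//.
pose nu := @measure_function_pushforward__canonical__measure_function_Measure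
  _ _ (measurableTypeR R) (measurableTypeR R) R lebesgue_measure _ (measurable_shift v).
apply: (@eq_measure_integral _ _ R setT lebesgue_measure nu) => A mA _.
apply/esym; apply: (@lebesgue_measure_unique R nu) => // B.
move=> [[x y] _ <-]; rewrite /nu/= /pushforward/=.
rewrite (_ : _ @^-1` _ = `](x - v)%R, (y - v)%R]%classic); last first.
  by apply/seteqP; split => z /=; rewrite !in_itv/= ltrBlDr lerBrDr.
rewrite !lebesgue_measure_itv/= !lte_fin ltrD2r; case: ifP => // _.
by rewrite -!EFinB opprD opprK addrACA addNr addr0.
Qed.

Lemma ge0_integral_cons N (f : N.+1.-tuple R -> \bar R) : measurable_fun setT f ->
  (forall t, 0 <= f t) ->
  \int[lebesgue_tuple N.+1]_t f t =
  \int[lebesgue_measure]_x \int[lebesgue_tuple N]_t f (cons_pair (x, t)).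
Proof.
move=> mf f0.
rewrite (@ge0_integral_pushforward _ _ (measurableTypeR R * N.-tuple R)%type
  (N.+1.-tuple R) R _ (@measurable_cons_pair R N)
  (lebesgue_measure \x lebesgue_tuple N) setT f)//.
rewrite preimage_setT fubini_tonelli1//; last by move=> x; exact: f0.
by apply: measurableT_comp => //; exact: measurable_cons_pair.
Qed.

Definition tuple_shift N (v : 'I_N -> R) (t : N.-tuple R) : N.-tuple R :=
  [tuple tnth t i + v i | i < N]%R.

Lemma measurable_tuple_shift N (v : 'I_N -> R) : measurable_fun setT (tuple_shift v).
Proof.
apply/measurable_fun_tnthP => i.
rewrite (_ : _ \o _ = fun t => (tnth t i + v i)%R); last first.
  by apply/funext => t; rewrite /= tnth_mktuple.
apply: measurable_funD; [exact: measurable_tnth|exact: measurable_cst].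
Qed.

Lemma ge0_integral_tuple_shift N (v : 'I_N -> R) (f : N.-tuple R -> \bar R) :
  measurable_fun setT f -> (forall t, 0 <= f t) ->
  \int[lebesgue_tuple N]_t f (tuple_shift v t) = \int[lebesgue_tuple N]_t f t.
Proof.
elim: N v f => [|N IH] v f mf f0.
  by apply: eq_integral => t _; congr f; rewrite [LHS]tuple0 [RHS]tuple0.
have mfv : measurable_fun setT (fun t => f (tuple_shift v t)).
  by apply: (measurableT_comp mf); exact: measurable_tuple_shift.
rewrite (ge0_integral_cons mf f0) (ge0_integral_cons mfv (fun=> f0 _)).
have mcons x : measurable_fun setT (fun t : N.-tuple R => cons_pair (x, t)).
  by apply: measurableT_comp; [exact: measurable_cons_pair|exact: measurable_pair1].
pose F x := \int[lebesgue_tuple N]_t f (cons_pair (x, t)).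
transitivity (\int[lebesgue_measure]_x F (x + v ord0)%R).
  apply: eq_integral => x _.
  have mfx : measurable_fun setT (fun t => f (cons_pair ((x + v ord0)%R, t))).
    by apply: (measurableT_comp mf); exact: mcons.
  rewrite /F; apply: etrans (IH (fun i => v (lift ord0 i)) _ mfx (fun=> f0 _)).
  apply: eq_integral => t _; congr f; apply: eq_from_tnth => i.
  rewrite tnth_mktuple; case: (unliftP ord0 i) => [j|] ->.
    by rewrite !tnthS tnth_mktuple.
  by rewrite !tnth0.
apply: ge0_integral_shift; last by move=> x; exact: integral_ge0.
rewrite /F; apply: (@measurable_fun_fubini_tonelli_F _ _ _ _ _ (lebesgue_tuple N)
  (f \o @cons_pair R N)) => [|x]; last exact: f0.
by apply: (measurableT_comp mf); exact: measurable_cons_pair.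
Qed.

Definition gauss_tuple N (t : N.-tuple R) : R :=
  expR (- \sum_i tnth t i ^+ 2)%R.

Lemma measurable_gauss_tuple N : measurable_fun setT (@gauss_tuple N).
Proof.
apply: measurableT_comp; first exact: measurable_expR.
apply: measurable_funN; apply: measurable_sum => i; apply: measurable_funX.
exact: measurable_tnth.
Qed.

Lemma integral_gauss_tuple N : \int[lebesgue_tuple N]_t (@gauss_tuple N t)%:E < +oo.
Proof.
have h0 n (t : n.-tuple R) : 0 <= (gauss_tuple t)%:E by rewrite lee_fin expR_ge0.
have mh n : measurable_fun setT (fun t : n.-tuple R => (gauss_tuple t)%:E).
  by apply/measurable_EFinP; exact: measurable_gauss_tuple.
elim: N => [|N IH].
  apply: (@le_lt_trans _ _ (\int[@lebesgue_tuple R 0]_t cst 1 t)).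
    apply: ge0_le_integral => //.
      exact: (mh 0%N).
    by move=> t _; rewrite /gauss_tuple big_ord0 oppr0 expR0.
  by rewrite integral_cst//= diracT mule1 ltry.
rewrite (ge0_integral_cons (mh N.+1) (h0 N.+1)).
pose c := \int[lebesgue_tuple N]_t (@gauss_tuple N t)%:E.
have c0 : 0 <= c by exact: integral_ge0.
rewrite (_ : \int[lebesgue_measure]_x _ =
    \int[lebesgue_measure]_x (c * (gauss_fun x)%:E)); last first.
  apply: eq_integral => x _; rewrite muleC /c -ge0_integralZl//; last 2 first.
  - exact: (mh N).
  - by rewrite lee_fin expR_ge0.
  apply: eq_integral => t _; rewrite -EFinM /gauss_tuple big_ord_recl opprD expRD.
  congr (expR (- (_ ^+ 2)) * expR (- _))%:E.
  by apply: eq_bigr => i _; rewrite tnthS.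
rewrite ge0_integralZl//; last 2 first.
- apply/measurable_EFinP.
  have mg := @measurable_gauss_fun R; exact mg.
- by move=> x _; rewrite lee_fin gauss_fun_ge0.
rewrite lte_mul_pinfty// ?ge0_fin_numE//.
by rewrite integralT_gauss ltry.
Qed.

End lebesgue_translation.

(** * Pinned configurations and the energy *)

Section pinned_configurations.
Context (R : realType) (Lambda : finType) (n : nat) (a : Lambda).
Notation N := #|@free_coord Lambda n a|.
Implicit Types (u : Lambda -> 'rV[R]_n) (t : N.-tuple R) (b : Lambda -> R).

Let pin t := pinned_config (0 : 'rV[R]_n) t.

Lemma pinned_config_pin t : pin t a = 0.
Proof. by rewrite /pin /pinned_config insubF// eqxx. Qed.

Lemma pinned_config_free t (j : {i : Lambda | i != a}) k :
  pin t (val j) 0 k = tnth t (enum_rank ((j, k) : @free_coord Lambda n a)).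
Proof. by rewrite /pin /pinned_config valK mxE. Qed.

(** The displacement of each spin [i] by [b i *: e1] in flattened coordinates; the pinned spin has
    no coordinate and stays in place. *)
Definition first_coord_shift b (r : 'I_N) : R :=
  let jk := enum_val r : @free_coord Lambda n a in b (val jk.1) * (e1 : 'rV[R]_n) 0 jk.2.

Lemma pinned_config_shift b t i : i != a ->
  pin (tuple_shift (first_coord_shift b) t) i = pin t i + b i *: e1.
Proof.
move=> ia; have -> : i = val (Sub i ia : {i : Lambda | i != a}) by rewrite SubK.
apply/rowP => k; rewrite !mxE !pinned_config_free tnth_mktuple; congr (_ + _).
by rewrite /first_coord_shift enum_rankK/= mxE.
Qed.

Lemma sum_sqnorm_pinned t : \sum_i sqnorm (pin t i) = \sum_r tnth t r ^+ 2.
Proof.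
rewrite (bigD1 a)//= pinned_config_pin {1}/sqnorm big1 => [|k _]; last first.
  by rewrite mxE expr0n.
rewrite add0r (reindex (@enum_rank (@free_coord Lambda n a)))/=; last first.
  by exists enum_val => r _; rewrite ?enum_rankK ?enum_valK.
transitivity (\sum_(j : {i : Lambda | i != a}) sqnorm (pin t (val j))).
  rewrite (reindex_omap (val : {i : Lambda | i != a} -> Lambda) insub)/=; last first.
    by move=> i ia; rewrite insubT.
  by apply: eq_bigl => j; rewrite (valP j) valK eqxx.
rewrite /sqnorm pair_big/=; apply: eq_bigr => -[j k] _.
by rewrite pinned_config_free.
Qed.

Lemma measurable_pinned_config i k : measurable_fun setT (fun t => pin t i 0 k).
Proof.
have [ia|ia] := eqVneq i a.
  rewrite (_ : (fun t => _) = cst 0); first exact: measurable_cst.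
  by apply/funext => t; rewrite ia pinned_config_pin mxE.
have -> : i = val (Sub i ia : {i : Lambda | i != a}) by rewrite SubK.
under eq_fun do rewrite pinned_config_free.
exact: measurable_tnth.
Qed.

Lemma measurable_half_sqnorm_theta s i :
  measurable_fun setT (fun t => half_sqnorm (theta s (pin t)) i).
Proof.
rewrite /half_sqnorm /sqnorm; apply: measurable_funM; last exact: measurable_cst.
apply: measurable_sum => k; apply: measurable_funX; rewrite /theta.
under eq_fun do rewrite mxE.
apply: measurable_funD; [exact: measurable_pinned_config|exact: measurable_cst].
Qed.

Lemma theta0 u : theta 0 u = u.
Proof. by apply/funext => i; rewrite /theta scale0r addr0. Qed.

Lemma measurable_half_sqnorm i : measurable_fun setT (fun t => half_sqnorm (pin t) i).
Proof.
have := measurable_half_sqnorm_theta 0 i.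
by under eq_fun do rewrite theta0.
Qed.

Lemma measurable_energy beta : measurable_fun setT (fun t => energy beta (pin t)).
Proof.
apply: measurable_funM; first exact: measurable_cst.
apply: measurable_sum => i; apply: measurable_sum => j.
apply: measurable_funM; first exact: measurable_cst.
apply: measurable_sum => k; apply: measurable_funX.
under eq_fun do rewrite !mxE.
by apply: measurable_funB; exact: measurable_pinned_config.
Qed.

Lemma sqnorm_ge0 (v : 'rV[R]_n) : 0 <= sqnorm v.
Proof. by apply: sumr_ge0 => k _; exact: sqr_ge0. Qed.

Lemma half_sqnorm_ge0 u i : 0 <= half_sqnorm u i.
Proof. by rewrite divr_ge0// sqnorm_ge0. Qed.

Lemma energy_ge0 beta u : (forall i j, 0 <= beta i j) -> 0 <= energy beta u.
Proof.
move=> b0; rewrite mulr_ge0 ?invr_ge0//; apply: sumr_ge0 => i _; apply: sumr_ge0 => j _.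
by rewrite mulr_ge0// sqnorm_ge0.
Qed.

Lemma double_half_sqnorm u : 2 * \sum_i half_sqnorm u i = \sum_i sqnorm (u i).
Proof. by rewrite mulr_sumr; apply: eq_bigr => i _; rewrite /half_sqnorm; field. Qed.

Lemma gauss_tuple_pinned t :
  expR (- (2 * \sum_i half_sqnorm (pin t) i)) = gauss_tuple t.
Proof. by rewrite double_half_sqnorm sum_sqnorm_pinned. Qed.

(** The pinned spin contributes nonnegatively to the exponent on the left and 0 on the right; the
    other spins agree. *)
Lemma gauss_tuple_theta s t :
  expR (- (2 * \sum_i half_sqnorm (theta s (pin t)) i)) <=
  gauss_tuple (tuple_shift (first_coord_shift (fun=> s)) t).
Proof.
rewrite double_half_sqnorm -gauss_tuple_pinned double_half_sqnorm ler_expR lerN2.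
apply: ler_sum => i _; have [->|ia] := eqVneq i a.
  rewrite pinned_config_pin /sqnorm big1 ?sqnorm_ge0// => k _.
  by rewrite mxE expr0n.
by rewrite pinned_config_shift.
Qed.

(** The coordinates of the spins decouple. The factor [1/4] of the energy is the [1/2] in front
    times the [1/2] inside [dirichlet]. *)
Lemma energy_dirichlet beta (k : Lambda -> R) u :
  energy beta u + \sum_i k i * half_sqnorm u i =
  2^-1 * \sum_(q < n) dirichlet beta k (fun i => u i 0 q) (fun i => u i 0 q).
Proof.
rewrite /dirichlet big_split/= mulrDr; congr (_ + _).
  rewrite -mulr_sumr mulrA -invfM -natrM; congr (_ * _).
  rewrite [RHS]exchange_big/=; apply: eq_bigr => i _.
  rewrite [RHS]exchange_big/=; apply: eq_bigr => j _.
  by rewrite /sqnorm mulr_sumr; apply: eq_bigr => q _; rewrite !mxE expr2.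
rewrite exchange_big mulr_sumr; apply: eq_bigr => i _.
rewrite -mulr_sumr mulrCA /half_sqnorm mulrC -mulrA [LHS]mulrCA; congr (_ * _).
Qed.

Lemma energy_theta beta s u : energy beta (theta s u) = energy beta u.
Proof.
rewrite /energy; congr (_ * _); apply: eq_bigr => i _; apply: eq_bigr => j _.
by rewrite /theta opprD addrACA subrr addr0.
Qed.

(* Completing the square along the harmonic extension [h]. *)
Lemma energy_theta_pinned beta (k h : Lambda -> R) c s t : (0 < n)%N ->
  (forall i j, beta i j = beta j i) -> h a = 1 ->
  (forall y, killed_laplacian beta k h y = c * (y == a)%:R) ->
  let t' := tuple_shift (first_coord_shift (fun i => s * (1 - h i))) t in
  energy beta (pin t) + \sum_i k i * half_sqnorm (theta s (pin t)) i =
  c * (s ^+ 2 / 2) + (energy beta (pin t') + \sum_i k i * half_sqnorm (pin t') i).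
Proof.
move=> n0 bsym ha hc t'; pose q0 := Ordinal n0.
(* Valid at [a] too, because [1 - h a = 0]: the translation respects the pinning. *)
have pin' i : pin t' i = pin t i + (s * (1 - h i)) *: e1.
  have [->|ia] := eqVneq i a; last exact: pinned_config_shift.
  by rewrite !pinned_config_pin ha subrr mulr0 scale0r addr0.
have Dh psi : dirichlet beta k h psi = c * psi a.
  rewrite dirichletE// (bigD1 a)//= hc eqxx mulr1 mulrC big1 ?addr0// => i /negbTE ia.
  by rewrite hc ia !mulr0.
rewrite -(energy_theta beta s (pin t)) !energy_dirichlet (bigD1 q0)//= [in RHS](bigD1 q0)//=.
pose psi i := pin t' i 0 q0.
have psia : psi a = 0 by rewrite /psi pinned_config_pin mxE.
(* The first coordinate is [s h] plus a field [psi] vanishing at [a], so the cross term [c * psi a]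
   drops out and [s h] contributes [s ^+ 2 * c]. *)
have -> : (fun i => theta s (pin t) i 0 q0) = (fun i => s * h i + psi i).
  by apply/funext => i; rewrite /psi pin' /theta !mxE/=; ring.
rewrite dirichletD.
have Ds phi : dirichlet beta k (fun i => s * h i) phi = s * (c * phi a).
  rewrite -Dh /dirichlet mulrDr; congr (_ + _).
    rewrite mulrCA; congr (_ * _); rewrite mulr_sumr; apply: eq_bigr => i _.
    by rewrite mulr_sumr; apply: eq_bigr => j _; ring.
  by rewrite mulr_sumr; apply: eq_bigr => i _; ring.
rewrite !Ds psia ha.
have -> : \sum_(q < n | q != q0)
     dirichlet beta k (fun i => theta s (pin t) i 0 q) (fun i => theta s (pin t) i 0 q) =
   \sum_(q < n | q != q0) dirichlet beta k (fun i => pin t' i 0 q) (fun i => pin t' i 0 q).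
  apply: eq_bigr => q qq0.
  have q1 : (q == 0%N :> nat) = false.
    by apply/negbTE; apply: contraNneq qq0 => q1; apply/eqP/val_inj.
  have -> : (fun i => theta s (pin t) i 0 q) = (fun i => pin t' i 0 q); last by [].
  by apply/funext => i; rewrite /theta pin' !mxE q1 !mulr0.
by field.
Qed.

End pinned_configurations.

(** * The isomorphism *)

Section measurability_of_tests.
Context (R : realType) (Lambda : finType) (d : measure_display)
  (T : measurableType d).
Implicit Types (Y : T -> Lambda -> R) (g : (Lambda -> R) -> R).

Lemma measurable_exp_sum s Y : (forall i, measurable_fun setT (fun w => Y w i)) ->
  measurable_fun setT (fun w => exp_sum s (Y w)).
Proof.
move=> mY; apply: measurable_sum => q; apply: measurable_funM; first exact: measurable_cst.
apply: measurableT_comp; first exact: measurable_expR.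
apply: measurable_funN; apply: measurable_sum => i.
by apply: measurable_funM; [exact: measurable_cst|exact: mY].
Qed.

(** For nonnegative [Y], [g] composed with [Y] is a limit of exponential sums. In general [Y] is cut
    off below at [- K] and translated by [K], then [K] grows; stopped local times may be negative
    off the event of the prescribed start. *)
Lemma measurable_test_comp g M Y : seq_continuous g ->
  (forall l, `|g l| * expR (2 * \sum_i l i) <= M) ->
  (forall i, measurable_fun setT (fun w => Y w i)) ->
  measurable_fun setT (fun w => g (Y w)).
Proof.
have pos g' M' Y' : seq_continuous g' ->
    (forall l, `|g' l| * expR (2 * \sum_i l i) <= M') ->
    (forall w i, 0 <= Y' w i) ->
    (forall i, measurable_fun setT (fun w => Y' w i)) ->
    measurable_fun setT (fun w => g' (Y' w)).
  move=> gc gM Y0 mY; have [s sP] := exp_sum_approx gc (fun l _ => gM l).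
  apply: (@measurable_fun_cvg _ _ _ _ (fun N w => exp_sum (s N) (Y' w))) => [N|w _].
    exact: measurable_exp_sum.
  by have [_] := sP (Y' w) (Y0 w).
move=> gc gM mY.
pose YK (K : nat) w i := Num.max (- K%:R) (Y w i).
have mYK K i : measurable_fun setT (fun w => YK K w i).
  by apply: measurable_maxr; [exact: measurable_cst|exact: mY].
apply: (@measurable_fun_cvg _ _ _ _ (fun K w => g (YK K w))) => [K|w _].
  pose gK l := g (fun i => l i - K%:R).
  rewrite (_ : (fun w => _) = fun w => gK (fun i => YK K w i + K%:R)); last first.
    by apply/funext => w; rewrite /gK; congr g; apply/funext => i; rewrite addrK.
  apply: (pos _ (M * expR (2 * \sum_(i : Lambda) K%:R))).
  - move=> y l yl; apply: gc => i; apply: cvgB; [exact: yl|exact: cvg_cst].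
  - move=> l; rewrite /gK.
    have -> : 2 * \sum_i l i = 2 * (\sum_i (l i - K%:R)) + 2 * \sum_(i : Lambda) K%:R.
      by rewrite -mulrDr -big_split/=; congr (_ * _); apply: eq_bigr => i _; rewrite subrK.
    by rewrite expRD mulrA ler_wpM2r ?expR_ge0.
  - by move=> w' i; rewrite -lerBlDr sub0r le_max lexx.
  - by move=> i; apply: measurable_funD; [exact: mYK|exact: measurable_cst].
apply: gc => i; apply: cvg_near_cst.
exists (Num.truncn `|Y w i|).+1 => // K /= KY; rewrite /YK; apply/max_idPr.
rewrite lerNl; apply: le_trans (ler_norm _) _; rewrite normrN.
by apply: le_trans (ltW (truncnS_gt _)) _; rewrite ler_nat.
Qed.

End measurability_of_tests.

Section gauss_integrable.
Context (R : realType) (N : nat).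

Lemma integrable_gauss_tuple_shift (v : 'I_N -> R) :
  (lebesgue_tuple N).-integrable setT (fun t => (gauss_tuple (tuple_shift v t))%:E).
Proof.
have mg : measurable_fun setT (fun t : N.-tuple R => (gauss_tuple t)%:E).
  by apply/measurable_EFinP; exact: measurable_gauss_tuple.
apply/integrableP; split.
  by apply: (measurableT_comp mg); exact: measurable_tuple_shift.
under eq_integral do rewrite gee0_abs ?lee_fin ?expR_ge0//.
have := ge0_integral_tuple_shift v mg (fun t => _ : 0 <= (gauss_tuple t)%:E)%E.
move=> ->; first exact: integral_gauss_tuple.
by move=> t; rewrite lee_fin expR_ge0.
Qed.

Lemma integrable_gauss_tuple :
  (lebesgue_tuple N).-integrable setT (fun t : N.-tuple R => (gauss_tuple t)%:E).
Proof.
apply/integrableP; split; first by apply/measurable_EFinP; exact: measurable_gauss_tuple.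
under eq_integral do rewrite gee0_abs ?lee_fin ?expR_ge0//.
exact: integral_gauss_tuple.
Qed.

End gauss_integrable.

Section stopped_local_time_means.
Context (R : realType) (Lambda : finType) (beta : Lambda -> Lambda -> R)
  (d : measure_display) (Omega : measurableType d)
  (P : Lambda -> (Lambda -> R) -> probability Omega R)
  (X : R -> Omega -> Lambda) (L0 : Lambda -> Omega -> R).
Hypothesis hbeta : edge_weights beta.
Hypothesis hX : simple_random_walk beta P X L0.
Variables (a : Lambda) (l : Lambda -> R) (gamma : R) (h : (Lambda -> nat) -> Lambda -> R)
  (c : (Lambda -> nat) -> R).
Hypothesis l0 : forall i, 0 <= l i.
Hypothesis la : l a = 0.
Hypothesis g0 : 0 <= gamma.
Hypothesis hP : forall kap, [/\ h kap a = 1, 0 <= c kap &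
  forall y, killed_laplacian beta (fun i => (kap i).+2%:R) (h kap) y =
            c kap * (y == a)%:R].

Let L := stopped_local_time X L0 a gamma.

(* Almost surely equal to [L], and at least [l] everywhere. *)
Let Lt w i := Num.max (l i) (L w i).

Let mL i : measurable_fun setT (fun w => L w i).
Proof. exact: (measurable_stopped_local_time hX a gamma i). Qed.

Let mLt i : measurable_fun setT (fun w => Lt w i).
Proof. by apply: measurable_maxr; [exact: measurable_cst|exact: mL]. Qed.

Let Lt_ge w i : l i <= Lt w i. Proof. by rewrite le_max lexx. Qed.

Let Lt0 w i : 0 <= Lt w i. Proof. exact: le_trans (l0 i) (Lt_ge w i). Qed.

Let LtE w : X 0 w = a /\ (forall j, L0 j w = l j) -> Lt w = L w.
Proof.
move=> [_ Ll]; apply/funext => i; apply/max_idPr; rewrite -Ll.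
exact: stopped_local_time_ge.
Qed.

Let mean_Lt (f : (Lambda -> R) -> R) :
  measurable_fun setT (fun w => f (L w)) -> measurable_fun setT (fun w => f (Lt w)) ->
  \int[P a l]_w f (Lt w) = \int[P a l]_w f (L w).
Proof.
move=> mf mft; apply: (Rintegral_eq_prob1 (measurable_start hX a l)) => //.
  exact: start_prob1 hX a l.
by move=> w /LtE ->.
Qed.

(** Closed form of the mean of [exp_sum] at the stopped local times. Nothing is assumed about
    measurability of [P a l] in [l]; this formula is explicitly measurable in [l], and the outer
    integral uses its limits. *)
Definition mean_exp_sum (s : seq (R * (Lambda -> nat))) : R :=
  \sum_(t <- s) t.1 * (expR (- \sum_i (t.2 i).+2%:R * l i) * expR (- (c t.2 * gamma))).

Let mean_exp_sumE s : \int[P a l]_w exp_sum s (Lt w) = mean_exp_sum s.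
Proof.
pose e (kap : Lambda -> nat) (y : Lambda -> R) := expR (- \sum_i (kap i).+2%:R * y i).
have me kap Y : (forall i, measurable_fun setT (fun w : Omega => Y w i)) ->
    measurable_fun setT (fun w => e kap (Y w)).
  move=> mY; apply: measurableT_comp; first exact: measurable_expR.
  apply: measurable_funN; apply: measurable_sum => i.
  by apply: measurable_funM; [exact: measurable_cst|exact: mY].
have e1 kap w : `|e kap (Lt w)| <= 1.
  rewrite ger0_norm ?expR_ge0// expR_le1 oppr_le0; apply: sumr_ge0 => i _.
  by rewrite mulr_ge0.
have ie kap : (P a l).-integrable setT (fun w => (e kap (Lt w))%:E).
  exact: (@bounded_prob_integrable _ _ _ (P a l) _ 1 (me kap _ mLt) (e1 kap)).
have Ee kap : \int[P a l]_w e kap (Lt w) =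
    expR (- \sum_i (kap i).+2%:R * l i) * expR (- (c kap * gamma)).
  rewrite mean_Lt; [|exact: me|exact: me].
  have [ha c0 hc] := hP kap.
  apply: (laplace_stopped_local_time hbeta hX la g0 (ltr0n R 1) _ ha c0 hc).
  by move=> i; rewrite ler_nat.
elim: s => [|t s IH].
  rewrite /mean_exp_sum big_nil; under eq_Rintegral do rewrite /exp_sum big_nil.
  by rewrite Rintegral_cst// mul0r.
rewrite /mean_exp_sum big_cons -/(mean_exp_sum s) -IH -Ee.
have iA : (P a l).-integrable setT (EFin \o (fun w => t.1 * e t.2 (Lt w))).
  by rewrite (_ : _ \o _ = fun w => (t.1%:E * (e t.2 (Lt w))%:E)%E)//; exact: integrableZl.
have iS : (P a l).-integrable setT (EFin \o (fun w => exp_sum s (Lt w))).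
  rewrite (_ : _ \o _ = (fun w => \sum_(q <- s) (q.1)%:E * (e q.2 (Lt w))%:E)%E).
    by apply: integrable_sum => // q _; exact: integrableZl.
  by apply/funext => w; rewrite /exp_sum/= -sumEFin; apply: eq_bigr => q _; rewrite EFinM.
rewrite -(RintegralZl t.1 measurableT (ie t.2)) -(RintegralD measurableT iA iS).
by apply: eq_Rintegral => w _; rewrite /exp_sum big_cons.
Qed.

(** Dominated convergence under [P a l]. Since [Lt] is at least [l] everywhere, the decay in the
    stopped local times becomes decay in [l], which later dominates the integral over
    configurations. *)
Lemma mean_test_approx (g : (Lambda -> R) -> R) (M : R)
    (s : nat -> seq (R * (Lambda -> nat))) : seq_continuous g ->
  (forall y, `|g y| * expR (2 * \sum_i y i) <= M) ->
  (forall y, (forall i, 0 <= y i) ->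
    (forall N, `|exp_sum (s N) y| <= M * expR (- (2 * \sum_i y i))) /\
    exp_sum (s N) y @[N --> \oo] --> g y) ->
  (forall N, `|mean_exp_sum (s N)| <= M * expR (- (2 * \sum_i l i))) /\
  mean_exp_sum (s N) @[N --> \oo] --> \int[P a l]_w g (L w).
Proof.
move=> gc gM sP; set B := M * _.
have M0 : 0 <= M by apply: le_trans (gM (fun=> 0)); rewrite mulr_ge0 ?expR_ge0.
have sB N w : `|exp_sum (s N) (Lt w)| <= B.
  have [/(_ N) + _] := sP _ (Lt0 w); move/le_trans; apply.
  rewrite ler_wpM2l// ler_expR lerN2 ler_pM2l//; apply: ler_sum => i _; exact: Lt_ge.
have ms N : measurable_fun setT (fun w => exp_sum (s N) (Lt w)) by exact: measurable_exp_sum.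
have intsN N : (P a l).-integrable setT (fun w => (exp_sum (s N) (Lt w))%:E).
  exact: (@bounded_prob_integrable _ _ _ (P a l) _ B (ms N) (sB N)).
have mg : measurable_fun setT (fun w => g (Lt w)) by exact: measurable_test_comp gc gM mLt.
have mgL : measurable_fun setT (fun w => g (L w)) by exact: measurable_test_comp gc gM mL.
have iB : (P a l).-integrable setT (EFin \o (cst B : Omega -> R)).
  by apply: (@bounded_prob_integrable _ _ _ (P a l) (cst B) `|B|).
split=> [N|].
  rewrite -mean_exp_sumE; apply: (@le_trans _ _ (\int[P a l]_w `|exp_sum (s N) (Lt w)|)).
    by apply: le_normr_Rintegral => //; exact: intsN.
  apply: (@le_trans _ _ (\int[P a l]_w (cst B w))).
    by apply: le_Rintegral => //; exact: (integrable_norm (intsN N)).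
  by rewrite Rintegral_cst// [X in fine X](@probability_setT _ _ _ (P a l)) mulr1.
under eq_fun do rewrite -mean_exp_sumE; rewrite -mean_Lt//.
apply: fine_cvg; rewrite fineK; last first.
  apply: integrable_fin_num => //.
  apply: (@bounded_prob_integrable _ _ _ (P a l) _ B mg) => w.
  have [_ cv] := sP _ (Lt0 w).
  apply: (ler_cvg_to (cvg_norm cv) (cvg_cst _)); apply: nearW => N; exact: sB.
apply: (@dominated_cvg _ _ _ _ _ _ _ _ (cst B%:E)) => //.
- by move=> N; apply/measurable_EFinP.
- move=> w _; apply: cvg_EFin; first exact: nearW.
  by have [_] := sP _ (Lt0 w).
- by move=> N w _; rewrite lee_fin.
Qed.

End stopped_local_time_means.

Section exponential_identity.
Context (R : realType) (Lambda : finType) (beta : Lambda -> Lambda -> R) (n : nat)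
  (a : Lambda) (s : R) (h : (Lambda -> nat) -> Lambda -> R) (c : (Lambda -> nat) -> R).
Hypothesis bsym : forall i j, beta i j = beta j i.
Hypothesis b0 : forall i j, 0 <= beta i j.
Hypothesis n0 : (0 < n)%N.
Hypothesis hP : forall kap, [/\ h kap a = 1, 0 <= c kap &
  forall y, killed_laplacian beta (fun i => (kap i).+2%:R) (h kap) y =
            c kap * (y == a)%:R].
Notation N := #|@free_coord Lambda n a|.
Let pin (t : N.-tuple R) := pinned_config (0 : 'rV[R]_n) t.

(** [r = s] is the shifted side, [r = 0] the side of the walk. *)
Let weight r (kap : Lambda -> nat) t : R :=
  expR (- \sum_i (kap i).+2%:R * half_sqnorm (theta r (pin t)) i) *
  expR (- energy beta (pin t)).

Let mweight r kap : measurable_fun setT (weight r kap).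
Proof.
apply: measurable_funM; (apply: measurableT_comp; first exact: measurable_expR);
  apply: measurable_funN; last exact: measurable_energy.
apply: measurable_sum => i; apply: measurable_funM; first exact: measurable_cst.
exact: measurable_half_sqnorm_theta.
Qed.

Let weight_le r kap t :
  `|weight r kap t| <= gauss_tuple (tuple_shift (first_coord_shift (fun=> r)) t).
Proof.
rewrite ger0_norm ?mulr_ge0 ?expR_ge0//; apply: le_trans (gauss_tuple_theta r t).
rewrite -[leRHS]mulr1 ler_pM ?expR_ge0//; last first.
  by rewrite expR_le1 oppr_le0 energy_ge0.
rewrite ler_expR lerN2 mulr_sumr; apply: ler_sum => i _.
by rewrite ler_wpM2r ?half_sqnorm_ge0// ler_nat.
Qed.

Let iweight r kap : (lebesgue_tuple N).-integrable setT (EFin \o weight r kap).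
Proof.
apply: (le_integrable measurableT _ _ (integrable_gauss_tuple_shift (first_coord_shift (fun=> r)))).
  by apply/measurable_EFinP; exact: mweight.
by move=> t _; rewrite /= lee_fin (le_trans (weight_le r kap t))// ler_norm.
Qed.

(** [energy_theta_pinned] makes the two integrands differ by the constant factor and a translation,
    which leaves the integral unchanged. *)
Let integral_weight kap : (\int[lebesgue_tuple N]_t (weight s kap t)%:E =
  (expR (- (c kap * (s ^+ 2 / 2))))%:E * \int[lebesgue_tuple N]_t (weight 0 kap t)%:E)%E.
Proof.
have [ha c0 hc] := hP kap.
pose v := first_coord_shift (n := n) (a := a) (fun i => s * (1 - h kap i)).
have m0 : measurable_fun setT (EFin \o weight 0 kap) by apply/measurable_EFinP; exact: mweight.
have w0 t : (0 <= (EFin \o weight 0 kap) t)%E by rewrite lee_fin mulr_ge0 ?expR_ge0.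
rewrite -[X in (_ * X)%E](ge0_integral_tuple_shift v m0 w0).
have mv : measurable_fun setT (fun t => (EFin \o weight 0 kap) (tuple_shift v t)).
  by apply: (measurableT_comp m0); exact: measurable_tuple_shift.
have Z := ge0_integralZl_EFin (lebesgue_tuple N) measurableT
  (fun t _ => w0 (tuple_shift v t)) mv (expR_ge0 (- (c kap * (s ^+ 2 / 2)))).
rewrite -[RHS]Z.
apply: eq_integral => t _; rewrite /= -EFinM /weight !theta0 -!expRD; congr (expR _)%:E.
have := energy_theta_pinned s t n0 bsym ha hc.
rewrite -/(pin t) -/v -/(pin (tuple_shift v t)) => E.
by rewrite -!opprD addrC E addrA [in RHS]addrA addrAC.
Qed.

Let integral_weightZ k r kap : (\int[lebesgue_tuple N]_t (k%:E * (weight r kap t)%:E) =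
  k%:E * \int[lebesgue_tuple N]_t (weight r kap t)%:E)%E.
Proof. by have Z := integralZl measurableT (iweight r kap) k; exact: Z. Qed.

Let iweightZ k r kap :
  (lebesgue_tuple N).-integrable setT (fun t => (k%:E * (weight r kap t)%:E)%E).
Proof. by have Z := integrableZl measurableT k (iweight r kap); exact: Z. Qed.

Lemma exp_sum_identity (r : seq (R * (Lambda -> nat))) :
  (\int[lebesgue_tuple N]_t
     (exp_sum r (half_sqnorm (theta s (pin t))) * expR (- energy beta (pin t)))%:E =
   \int[lebesgue_tuple N]_t
     (mean_exp_sum (half_sqnorm (pin t)) (s ^+ 2 / 2) c r *
      expR (- energy beta (pin t)))%:E)%E.
Proof.
transitivity (\sum_(q <- r) q.1%:E * \int[lebesgue_tuple N]_t (weight s q.2 t)%:E)%E.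
  transitivity (\int[lebesgue_tuple N]_t (\sum_(q <- r) q.1%:E * (weight s q.2 t)%:E))%E.
    apply: eq_integral => t _; rewrite /exp_sum mulr_suml -sumEFin.
    by apply: eq_bigr => q _; rewrite -mulrA.
  rewrite [LHS](integral_sum measurableT (fun q => iweightZ q.1 s q.2)).
  by apply: eq_bigr => q _; exact: integral_weightZ.
transitivity (\int[lebesgue_tuple N]_t (\sum_(q <- r)
    (q.1 * expR (- (c q.2 * (s ^+ 2 / 2))))%:E * (weight 0 q.2 t)%:E))%E.
  rewrite [RHS](integral_sum measurableT (fun q => iweightZ _ 0 q.2)).
  by apply: eq_bigr => q _; rewrite integral_weightZ integral_weight muleA EFinM.
apply: eq_integral => t _; rewrite /mean_exp_sum mulr_suml -sumEFin.
by apply: eq_bigr => q _; rewrite -EFinM /weight theta0; congr EFin; ring.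
Qed.

Lemma measurable_mean_exp_sum gamma (r : seq (R * (Lambda -> nat))) :
  measurable_fun setT (fun t => mean_exp_sum (half_sqnorm (pin t)) gamma c r).
Proof.
apply: measurable_sum => q; apply: measurable_funM; first exact: measurable_cst.
apply: measurable_funM; last exact: measurable_cst.
apply: measurableT_comp; first exact: measurable_expR.
apply: measurable_funN; apply: measurable_sum => i.
by apply: measurable_funM; [exact: measurable_cst|exact: measurable_half_sqnorm].
Qed.

End exponential_identity.

Theorem theorem2p5 (R : realType) (Lambda : finType)
    (beta : Lambda -> Lambda -> R) (hbeta : edge_weights beta)
    (n : nat) (hn : (0 < n)%N)
    (d : measure_display) (Omega : measurableType d)
    (P : Lambda -> (Lambda -> R) -> probability Omega R)
    (X : R -> Omega -> Lambda) (L0 : Lambda -> Omega -> R)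
    (hX : simple_random_walk beta P X L0)
    (g : {ptws Lambda -> R} -> R) (hg : smooth g)
    (hgc : compactly_supported g)
    (a : Lambda) (s : R) :
  pinned_expectation beta a (0 : 'rV[R]_n)
    (fun u => (g (half_sqnorm (theta s u)))%:E) =
  pinned_expectation beta a (0 : 'rV[R]_n)
    (fun u => ('E_(P a (half_sqnorm u))
       [fun w => g (local_time X L0 (tau X L0 a (s ^+ 2 / 2) w) w)])%E).
Proof.
have [bsym b0 _] := hbeta.
have gcont : continuous g by have [] := hg [::].
have gc : seq_continuous g := continuous_seq_continuous gcont.
have [M [gB gM]] := compactly_supported_bound gcont hgc.
have M0 : 0 <= M by apply: le_trans (gM (fun=> 0)); rewrite mulr_ge0 ?expR_ge0.
have [r rP] := exp_sum_approx gc (fun l _ => gM l).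
have /choice[h /choice[c hP]] : forall kap : Lambda -> nat, exists h : Lambda -> R, exists c,
    [/\ h a = 1, 0 <= c & forall y, killed_laplacian beta (fun i => (kap i).+2%:R) h y =
      c * (y == a)%:R].
  move=> kap; have kap0 i : 0 < (kap i).+2%:R :> R by [].
  by have [h [c [ha c0 _ hc]]] := killed_harmonic a bsym b0 kap0; exists h, c.
pose gamma := s ^+ 2 / 2.
have gamma0 : 0 <= gamma by rewrite divr_ge0 ?sqr_ge0.
pose N := #|@free_coord Lambda n a|.
pose pin (t : N.-tuple R) := pinned_config (0 : 'rV[R]_n) t.
pose w t := expR (- energy beta (pin t)).
have w1 t : `|w t| <= 1.
  by rewrite ger0_norm ?expR_ge0// expR_le1 oppr_le0 energy_ge0.
have mw : measurable_fun setT w.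
  apply: measurableT_comp; first exact: measurable_expR.
  by apply: measurable_funN; exact: measurable_energy.
pose E t := \int[P a (half_sqnorm (pin t))]_o
  g (stopped_local_time X L0 a gamma o).
(* The expectation is extended-real valued; as [g] is bounded it is finite and equals the real
   integral [E t]. *)
have EE t : ('E_(P a (half_sqnorm (pin t)))
    [fun o => g (local_time X L0 (tau X L0 a gamma o) o)] = (E t)%:E)%E.
  rewrite unlock /E fineK//; apply: integrable_fin_num => //.
  apply: (@bounded_prob_integrable _ _ _ _ (fun o => g (stopped_local_time X L0 a gamma o)) M) => //.
  by apply: (measurable_test_comp gc gM) => i; exact: (measurable_stopped_local_time hX a gamma i).
rewrite /pinned_expectation -/N.
under [RHS]eq_integral do rewrite -/(pin _) EE -EFinM -/(w _).
under [LHS]eq_integral do rewrite -EFinM -/(pin _) -/(w _).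
have lhs : (\int[lebesgue_tuple N]_t (exp_sum (r K) (half_sqnorm (theta s (pin t))) * w t)%:E)%E
    @[K --> \oo] --> (\int[lebesgue_tuple N]_t (g (half_sqnorm (theta s (pin t))) * w t)%:E)%E.
  apply: (@dominated_cvg _ _ _ _ _ _ _ _
    (fun t => (M%:E * (gauss_tuple (tuple_shift (first_coord_shift (fun=> s)) t))%:E)%E)) => //.
  - move=> K; apply/measurable_EFinP; apply: measurable_funM => //.
    by apply: measurable_exp_sum => i; exact: measurable_half_sqnorm_theta.
  - move=> t _; apply: cvg_EFin; first exact: nearW.
    have [_ cv] := rP _ (half_sqnorm_ge0 (theta s (pin t))).
    exact: (cvgM cv (cvg_cst _)).
  - by apply: integrableZl => //; exact: integrable_gauss_tuple_shift.
  - move=> K t _; rewrite lee_fin normrM -[leRHS]mulr1 ler_pM//.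
    have [/(_ K) + _] := rP _ (half_sqnorm_ge0 (theta s (pin t))); move/le_trans; apply.
    by rewrite ler_wpM2l// gauss_tuple_theta.
have rhs : (\int[lebesgue_tuple N]_t (mean_exp_sum (half_sqnorm (pin t)) gamma c (r K) * w t)%:E)%E
    @[K --> \oo] --> (\int[lebesgue_tuple N]_t (E t * w t)%:E)%E.
  (* The pinning at 0 makes the initial local time at [a] vanish, as the Laplace transform formula
     requires. *)
  have pa t : half_sqnorm (pin t) a = 0.
    by rewrite /half_sqnorm /pin pinned_config_pin /sqnorm big1 ?mul0r// => k _; rewrite mxE expr0n.
  have approx t := mean_test_approx hbeta hX (half_sqnorm_ge0 (pin t)) (pa t) gamma0 hP gc gM rP.
  apply: (@dominated_cvg _ _ _ _ _ _ _ _ (fun t => (M%:E * (gauss_tuple t)%:E)%E)) => //.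
  - move=> K; apply/measurable_EFinP; apply: measurable_funM => //.
    exact: measurable_mean_exp_sum.
  - move=> t _; apply: cvg_EFin; first exact: nearW.
    have [_ cv] := approx t; exact: (cvgM cv (cvg_cst _)).
  - by apply: integrableZl => //; exact: integrable_gauss_tuple.
  - move=> K t _; rewrite lee_fin normrM -[leRHS]mulr1 ler_pM//.
    by have [/(_ K) + _] := approx t; rewrite gauss_tuple_pinned.
have eq_K : (fun K => \int[lebesgue_tuple N]_t
     (exp_sum (r K) (half_sqnorm (theta s (pin t))) * w t)%:E)%E =
   (fun K => \int[lebesgue_tuple N]_t (mean_exp_sum (half_sqnorm (pin t)) gamma c (r K) * w t)%:E)%E.
  by apply/funext => K; exact: (exp_sum_identity s bsym b0 hn hP (r K)).
rewrite eq_K in lhs.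
exact: (cvg_unique _ lhs rhs).
Qed.
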